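(* Let $m$ and $k$ be positive integers and let $n = km$. Then $$\Big\langle s_{m^{n-m}}\, s_{(n-m)^m},\; s_{m^m}^{2(k-1)} \Big\rangle \;=\; \Big\langle \Big( \sum_{\lambda \subset m^m} s_{\lambda}\, s'_{\tilde{\lambda}^*} \Big)^{2(k-1)},\; s_{(n-m)^m}\, s'_{(n-m)^m} \Big\rangle ,$$ where the pairing on the left is on $\Lambda$ and the pairing on the right is on $\Lambda \otimes \Lambda$. That is, the right-hand side equals $g(m,n)$, where $g(m,n)$ is by definition the left-hand side.
   Context: $\Lambda$ is the ring of symmetric functions over $\mathbb{Z}$ in infinitely many variables, and $s_\lambda$ is the Schur function of the partition $\lambda$. The bilinear pairing $\langle -,-\rangle$ on $\Lambda$ is the one for which the Schur functions are orthonormal. In $\Lambda \otimes \Lambda$, unprimed symmetric functions refer to the first factor (first set of variables) and primed ones to the second factor (second set of variables). The pairing on $\Lambda\otimes\Lambda$ is the one for which the products $s_\lambda s'_\mu$ (over all pairs of partitions) are orthonormal. For integers $a, b \ge 0$, $a^b$ denotes the partition $(a,a,\dots,a)$ with $b$ parts, i.e. the rectangular Young diagram with $b$ rows and $a$ columns (the empty partition if $a=0$ or $b=0$). The notation $\lambda \subset m^m$ means that the Young diagram of $\lambda$ fits in the $m \times m$ square, i.e. $\lambda$ has at most $m$ rows and at most $m$ columns. For such $\lambda$, the dual $\lambda^*$ is the complementary partition in the square, $\lambda^*_i = m - \lambda_{m+1-i}$ for $1\le i\le m$. The tilde denotes the transpose (conjugate) partition, and $\tilde{\lambda}^*$ is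 the transpose of the dual of $\lambda$ (for the square, the two operations commute). *)

(* Defs.v *)
From HB Require Import structures.
From mathcomp Require Import all_boot all_order all_algebra.
From mathcomp Require Import boolp.
From mathcomp Require Import mpoly.

Set Implicit Arguments.
Unset Strict Implicit.
Unset Printing Implicit Defensive.

Import Order.TTheory GRing.Theory Num.Theory.
Local Open Scope ring_scope.

(* A (symmetric) function in infinitely many variables is encoded by its
   restrictions to the first n variables, for all n. Such families live in the
   product ring below, with componentwise operations. *)
Definition family (R : nat -> comNzRingType) : Type := forall n, R n.

Section FamilyRing.
Variable R : nat -> comNzRingType.
Implicit Types f g h : family R.

HB.instance Definition _ := Choice.copy (family R) (forall n, R n).

Definition fam_add f g : family R := fun n => f n + g n.
Definition fam_opp f : family R := fun n => - f n.
Definition fam_mul f g : family R := fun n => f n * g n.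

Fact fam_addA : associative fam_add.
Proof. by move=> f g h; apply: functional_extensionality_dep => n; apply: addrA. Qed.
Fact fam_addC : commutative fam_add.
Proof. by move=> f g; apply: functional_extensionality_dep => n; apply: addrC. Qed.
Fact fam_add0 : left_id (fun n => 0 : R n) fam_add.
Proof. by move=> f; apply: functional_extensionality_dep => n; apply: add0r. Qed.
Fact fam_addN : left_inverse (fun n => 0 : R n) fam_opp fam_add.
Proof. by move=> f; apply: functional_extensionality_dep => n; apply: addNr. Qed.
HB.instance Definition _ :=
  GRing.isZmodule.Build (family R) fam_addA fam_addC fam_add0 fam_addN.

Fact fam_mulA : associative fam_mul.
Proof. by move=> f g h; apply: functional_extensionality_dep => n; apply: mulrA. Qed.
Fact fam_mulC : commutative fam_mul.
Proof. by move=> f g; apply: functional_extensionality_dep => n; apply: mulrC. Qed.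
Fact fam_mul1 : left_id (fun n => 1 : R n) fam_mul.
Proof. by move=> f; apply: functional_extensionality_dep => n; apply: mul1r. Qed.
Fact fam_mulD : left_distributive fam_mul fam_add.
Proof. by move=> f g h; apply: functional_extensionality_dep => n; apply: mulrDl. Qed.
Fact fam_1neq0 : (fun n => 1 : R n) != 0 :> family R.
Proof.
by apply/eqP => /(congr1 (fun f : family R => f 0%N)) /eqP; rewrite oner_eq0.
Qed.
HB.instance Definition _ := GRing.Zmodule_isComNzRing.Build (family R)
  fam_mulA fam_mulC fam_mul1 fam_mulD fam_1neq0.

Lemma famD f g n : (f + g) n = f n + g n. Proof. by []. Qed.
Lemma famM f g n : (f * g) n = f n * g n. Proof. by []. Qed.

End FamilyRing.

(* One set of variables x_1, ..., x_n; two sets x_1, ..., x_n, x'_1, ..., x'_n,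
   the primed variables being the last n. *)
Definition fam1 : comNzRingType :=
  family (fun n => {mpoly int[n]} : comNzRingType).
Definition fam2 : comNzRingType :=
  family (fun n => {mpoly int[n + n]} : comNzRingType).

Definition kill_last n (p : {mpoly int[n.+1]}) : {mpoly int[n]} :=
  p \mPo [tuple (if unlift ord_max i is Some j then 'X_j else 0) | i < n.+1].

(* Lambda is the graded inverse limit of the rings of symmetric polynomials:
   its elements are the compatible families of symmetric polynomials of
   bounded degree. *)
Record in_Lambda (f : fam1) : Prop := InLambda {
  Lambda_sym : forall n, (f n : {mpoly int[n]}) \is symmetric;
  Lambda_compat : forall n, kill_last (f n.+1) = f n;
  Lambda_bounded :
    exists d : nat, forall n, (msize (f n : {mpoly int[n]}) <= d)%N }.

(* tens f g = f g', with f in the unprimed and g in the primed variables. *)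
Definition tens (f g : fam1) : fam2 := fun n =>
  ((f n : {mpoly int[n]}) \mPo [tuple 'X_(lshift n i) | i < n]) *
  ((g n : {mpoly int[n]}) \mPo [tuple 'X_(rshift n i) | i < n]).

(* Lambda (x) Lambda is realized inside the functions of two sets of
   variables, as the additive span of the products f g'. *)
Definition in_Lambda2 (F : fam2) : Prop :=
  exists2 s : seq (fam1 * fam1),
    (forall p, p \in s -> in_Lambda p.1 /\ in_Lambda p.2) &
    F = \sum_(p <- s) tens p.1 p.2.

Definition is_part (la : seq nat) : bool := sorted geq la && (0%N \notin la).

Definition strip (la : seq nat) : seq nat := [seq i <- la | i != 0%N].

(* a^b: b parts equal to a *)
Definition rect (a b : nat) : seq nat := strip (nseq b a).

Definition conj_part (la : seq nat) : seq nat :=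
  mkseq (fun j => count (fun i => (j < i)%N) la) (head 0%N la).

(* The complement in the square m^m; rows are numbered from 0. *)
Definition dual_part (m : nat) (la : seq nat) : seq nat :=
  strip (mkseq (fun i => m - nth 0%N la (m - i.+1))%N m).

(* All partitions contained in m^m, without repetition: see mem_square_parts
   and square_parts_uniq. *)
Definition square_parts (m : nat) : seq (seq nat) :=
  [seq strip [seq val i | i <- tval t] |
     t <- enum {: m.-tuple 'I_m.+1} & sorted geq [seq val i | i <- tval t]].

Lemma sorted_stripE (s : seq nat) : sorted geq s ->
  strip s ++ nseq (size s - size (strip s)) 0%N = s.
Proof.
elim: s => [|x s IHs] //= s_srt; have /IHs {}IHs := path_sorted s_srt.
case: x s_srt => [|x] s_srt /=; last by rewrite subSS IHs.
have s0 : s = nseq (size s) 0%N.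
  apply/all_pred1P/allP => y ys.
  have := order_path_min (rev_trans leq_trans) s_srt.
  by move/allP/(_ y ys); rewrite /= leqn0.
have -> : strip s = [::].
  by rewrite /strip s0; elim: (size s) => //= n ->.
by rewrite [LHS]/= {2}s0.
Qed.

Lemma strip_is_part (s : seq nat) : sorted geq s -> is_part (strip s).
Proof.
move=> s_srt; rewrite /is_part mem_filter eqxx andbT.
exact: sorted_filter (rev_trans leq_trans) _ _ s_srt.
Qed.

Lemma mem_square_parts m la : (la \in square_parts m) =
  [&& is_part la, size la <= m & all (fun i => i <= m) la]%N.
Proof.
apply/mapP/and3P => [[t] | [/andP[la_srt la0] la_m la_le]].
  rewrite mem_filter => /andP[t_srt _] ->; split; first exact: strip_is_part.
    by rewrite size_filter (leq_trans (count_size _ _)) // size_map size_tuple.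
  apply/allP => x; rewrite mem_filter => /andP[_ /mapP[i _ ->]].
  by rewrite -ltnS ltn_ord.
pose s := la ++ nseq (m - size la) 0%N.
have s_m : size [seq inord i : 'I_m.+1 | i <- s] == m.
  by rewrite size_map size_cat size_nseq subnKC.
have sE : [seq val i | i <- [seq inord i : 'I_m.+1 | i <- s]] = s.
  rewrite -map_comp map_id_in // => i.
  rewrite mem_cat => /orP[/(allP la_le) /= i_m | ].
    by rewrite inordK.
  by rewrite mem_nseq => /andP[_ /eqP ->] /=; rewrite inordK.
exists (Tuple s_m); last first.
  rewrite /= sE /strip filter_cat.
  rewrite (all_filterP _) //; last first.
    by apply/allP => i i_la; apply: contraNneq la0 => <-.
  by elim: (m - size la)%N => [|n IHn] /=; rewrite ?cats0.
rewrite mem_filter mem_enum andbT /= sE (sorted_pairwise (rev_trans leq_trans)).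
rewrite pairwise_cat -(sorted_pairwise (rev_trans leq_trans)) la_srt /=.
apply/andP; split.
  by apply/allrelP => x y _; rewrite mem_nseq => /andP[_ /eqP ->].
elim: (m - size la)%N => [|n IHn] //=.
by rewrite IHn andbT all_nseq leqnn orbT.
Qed.

Lemma square_parts_uniq m : uniq (square_parts m).
Proof.
rewrite map_inj_in_uniq; first exact/filter_uniq/enum_uniq.
move=> t u.
rewrite !mem_filter => /andP[t_srt _] /andP[u_srt _] eq_tu.
apply/val_inj/(inj_map val_inj).
rewrite -(sorted_stripE t_srt) -(sorted_stripE u_srt) eq_tu.
by rewrite !size_map !size_tuple.
Qed.

(* Cells (i, j) of the Young diagram, rows and columns numbered from 0. *)
Definition cell (la : seq nat) : finType :=
  {i : 'I_(size la) & 'I_(nth 0%N la i)}.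
Definition cell_row la (c : cell la) : nat := tag c.
Definition cell_col la (c : cell la) : nat := tagged c.

Definition ssyt (la : seq nat) n (T : {ffun cell la -> 'I_n}) : bool :=
  [forall c : cell la, forall d : cell la,
    ((cell_row c == cell_row d) && (cell_col c <= cell_col d)%N
       ==> (T c <= T d)%N) &&
    ((cell_col c == cell_col d) && (cell_row c < cell_row d)%N
       ==> (T c < T d)%N)].

(* The Schur function, as the generating function of semistandard tableaux. *)
Definition schur (la : seq nat) : fam1 := fun n =>
  \sum_(T : {ffun cell la -> 'I_n} | ssyt T) \prod_(c : cell la) 'X_(T c).

(* B restricts to a Z-bilinear pairing on the subgroup P; its values outside P
   are irrelevant. *)
Definition bilinear_on (V : zmodType) (P : V -> Prop) (B : V -> V -> int) :=
  (forall (a : int) f g h, P f -> P g -> P h ->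
     B (f *~ a + g) h = a * B f h + B g h) /\
  (forall (a : int) f g h, P f -> P g -> P h ->
     B h (f *~ a + g) = a * B h f + B h g).

(* The Schur functions form a Z-basis of Lambda, so exactly one pairing on
   Lambda has this property; likewise on Lambda (x) Lambda. *)
Definition schur_pairing (B : fam1 -> fam1 -> int) : Prop :=
  bilinear_on in_Lambda B /\
  forall la mu, is_part la -> is_part mu ->
    B (schur la) (schur mu) = (la == mu)%:R.

Definition schur_pairing2 (B : fam2 -> fam2 -> int) : Prop :=
  bilinear_on in_Lambda2 B /\
  forall la mu al be, is_part la -> is_part mu -> is_part al -> is_part be ->
    B (tens (schur la) (schur mu)) (tens (schur al) (schur be))
      = ((la == al) && (mu == be))%:R.

(* Main.v *)
(* Write h_a for the products of complete symmetric functions. The coefficient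
   of s_nu in h_a and the coefficient of x^a in s_nu are both Kostka numbers (by
   Pieri's rule and by the branching of tableaux). Hence <h_a, f> is the
   coefficient of x^a in f, multiplication is adjoint to the coproduct
   f |-> f(x, y), and, replacing h by e and Pieri's rule for horizontal strips by
   that for vertical strips, the transposition omega is multiplicative.
   The coproduct of s_{m^m} is the sum of the s_la s'_{la^*} over the partitions
   la in the square, so the left-hand side is the coefficient of
   s_{m^{n-m}} s'_{(n-m)^m} in the power of this sum. Applying omega to the first
   factor and summing over the transposes of the la gives the right-hand side. *)
Require Import Defs.
From HB Require Import structures.
From mathcomp Require Import all_boot all_order all_algebra all_fingroup.
From mathcomp Require Import boolp mpoly zify.
Set Implicit Arguments.
Unset Strict Implicit.
Unset Printing Implicit Defensive.
Import GRing.Theory.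
Local Open Scope ring_scope.

(** * Partitions *)

(** Everything is computed in finitely many variables. Write a_g for the alternant with exponents g.
    Since a_delta s_la = a_(la + delta), the coefficient of s_nu in a symmetric polynomial p is the
    coefficient of x^(nu + delta) in a_delta p. This number serves as the definition ([alt_coef]):
    it is additive, stable in the number of variables, and turns Pieri's rules into cancellations
    among values of an alternating function. The remaining obstacle is to pass from products of the
    h_r to Schur functions. Expanding a_delta over the permutations writes the coefficient of s_la
    as a signed sum of monomial coefficients; as the coefficient of s_la in s_nu is also that of
    s_nu in s_la, the same signed sum expresses s_la through products of the h_r. Hence omega need
    not be constructed as a map: one list of terms, read with the h_r or with the e_r, yields a
    Schur function or its transpose. The pairings are known only by their properties, so they are
    evaluated on finite Schur expansions, cut off by a square of side [D]. *)

Lemma reindex_seq (V : nmodType) (I J : eqType) (s : seq I) (s' : seq J)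
    (P : pred I) (P' : pred J) (f : I -> J) (F : I -> V) (G : J -> V) :
  uniq s -> uniq s' ->
  (forall i, i \in s -> P i -> [/\ f i \in s', P' (f i) & F i = G (f i)]) ->
  (forall i k, i \in s -> k \in s -> P i -> P k -> f i = f k -> i = k) ->
  (forall j, j \in s' -> P' j -> exists2 i, (i \in s) && P i & f i = j) ->
  \sum_(i <- s | P i) F i = \sum_(j <- s' | P' j) G j.
Proof.
move=> us us' fP finj fsurj.
rewrite -[LHS]big_filter -[RHS]big_filter.
have -> : \sum_(i <- [seq i <- s | P i]) F i
    = \sum_(j <- [seq f i | i <- [seq i <- s | P i]]) G j.
  rewrite big_map !big_seq; apply: eq_bigr => i.
  by rewrite mem_filter => /andP[Pi si]; have [] := fP i si Pi.
apply: perm_big; apply: uniq_perm.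
- rewrite map_inj_in_uniq ?filter_uniq // => i k.
  by rewrite !mem_filter => /andP[Pi si] /andP[Pk sk]; apply: finj.
- exact: filter_uniq.
move=> j; rewrite mem_filter; apply/mapP/andP => [[i]|[Pj sj]].
  by rewrite mem_filter => /andP[Pi si] ->; have [] := fP i si Pi.
have [i /andP[si Pi] <-] := fsurj j sj Pj.
by exists i; rewrite ?mem_filter ?Pi.
Qed.

Section Partitions.
Local Open Scope nat_scope.
Implicit Types la mu ka nu : seq nat.

Lemma sorted_nth_le s i j : sorted geq s -> i <= j -> nth 0 s j <= nth 0 s i.
Proof.
move=> s_srt le_ij; case: (ltnP j (size s)) => [lt_js|]; last first.
  by move/(nth_default 0) ->.
have geqT : transitive geq by exact: rev_trans leq_trans.
have geqR : reflexive geq by exact: leqnn.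
exact: (sorted_leq_nth geqT geqR 0 s_srt _ _ (leq_ltn_trans le_ij lt_js) lt_js le_ij).
Qed.

Lemma part_sorted la : is_part la -> sorted geq la.
Proof. by case/andP. Qed.

Lemma part_nth_le la i j : is_part la -> i <= j -> nth 0 la j <= nth 0 la i.
Proof. by move=> /part_sorted; apply: sorted_nth_le. Qed.

Lemma part_nth_gt0 la i : is_part la -> (0 < nth 0 la i) = (i < size la).
Proof.
case/andP=> _ la0; case: (ltnP i (size la)) => [lt_i|/(nth_default 0) ->//].
by rewrite lt0n; apply: contraNneq la0 => <-; apply: mem_nth.
Qed.

Lemma part_size_le la n : is_part la -> (size la <= n) = (nth 0 la n == 0).
Proof. by move=> pla; rewrite leqNgt -part_nth_gt0 // lt0n negbK. Qed.

Lemma part_eq la mu :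
  is_part la -> is_part mu -> nth 0 la =1 nth 0 mu -> la = mu.
Proof.
move=> pla pmu eq_nth; apply: (@eq_from_nth _ 0) => [|i _]; last exact: eq_nth.
apply/eqP; rewrite eqn_leq part_size_le // eq_nth nth_default //=.
by rewrite part_size_le // -eq_nth nth_default.
Qed.

Lemma nth_strip s i : sorted geq s -> nth 0 (strip s) i = nth 0 s i.
Proof.
move=> /sorted_stripE {2}<-; rewrite nth_cat nth_nseq if_same.
by case: ltnP => // /(nth_default 0).
Qed.

Lemma size_strip s : size (strip s) <= size s.
Proof. by rewrite size_filter count_size. Qed.

Lemma mkseq_sorted f n :
  (forall i, i.+1 < n -> f i.+1 <= f i) -> sorted geq (mkseq f n).
Proof.
move=> fP; apply/(sortedP 0) => i; rewrite size_mkseq => lt_in.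
by rewrite /= !nth_mkseq // ?fP // ltnW.
Qed.

Definition part_of (f : nat -> nat) n := strip (mkseq f n).

Lemma part_ofP f n : (forall i, i.+1 < n -> f i.+1 <= f i) ->
  is_part (part_of f n) /\
  forall i, nth 0 (part_of f n) i = if i < n then f i else 0.
Proof.
move=> fP; have srt := mkseq_sorted fP; split; first exact: strip_is_part.
move=> i; rewrite nth_strip //; case: ltnP => lt_in; first by rewrite nth_mkseq.
by rewrite nth_default ?size_mkseq.
Qed.

Lemma size_part_of f n : size (part_of f n) <= n.
Proof. by rewrite (leq_trans (size_strip _)) ?size_mkseq. Qed.

Lemma sumn_nth s n : size s <= n -> sumn s = \sum_(i < n) nth 0 s i.
Proof.
move=> le_sn; rewrite sumnE (big_nth 0) big_mkord.
rewrite (big_ord_widen _ (fun i => nth 0 s i) le_sn) big_mkcond.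
by apply: eq_bigr => i _; case: ltnP => // /(nth_default 0).
Qed.

Lemma nth_le_sumn s i : nth 0 s i <= sumn s.
Proof.
elim: s i => [|x s IHs] [|i] //=; first exact: leq_addr.
exact: leq_trans (IHs i) (leq_addl _ _).
Qed.

Lemma part_size_sumn la : is_part la -> size la <= sumn la.
Proof.
case/andP=> _; elim: la => //= x la IHla; rewrite inE negb_or => /andP[x0 la0].
by rewrite -add1n leq_add ?IHla // lt0n eq_sym.
Qed.

Lemma square_partsP D la : reflect
  [/\ is_part la, size la <= D & forall i, nth 0 la i <= D]
  (la \in square_parts D).
Proof.
rewrite mem_square_parts; apply: (iffP and3P) => [] [pla sla leD]; split=> //.
  move=> i; case: (ltnP i (size la)) => [lt_i|/(nth_default 0) -> //].
  exact: (allP leD _ (mem_nth 0 lt_i)).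
by apply/(all_nthP 0) => i _; apply: leD.
Qed.

Lemma square_parts_sumn D la :
  is_part la -> sumn la <= D -> la \in square_parts D.
Proof.
move=> pla le_D; apply/square_partsP; split=> //.
  exact: leq_trans (part_size_sumn pla) le_D.
by move=> i; apply: leq_trans (nth_le_sumn _ _) le_D.
Qed.

Lemma square_parts_part D la : la \in square_parts D -> is_part la.
Proof. by case/square_partsP. Qed.

Lemma square_parts_sub D D' la :
  D <= D' -> la \in square_parts D -> la \in square_parts D'.
Proof.
move=> le_D /square_partsP[pla sla nla]; apply/square_partsP; split=> //.
  exact: leq_trans sla le_D.
by move=> i; apply: leq_trans (nla i) le_D.
Qed.

(* In a strip, [la] is the larger shape. *)
Definition hstrip la ka := all
  (fun i => (nth 0 la i.+1 <= nth 0 ka i) && (nth 0 ka i <= nth 0 la i))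
  (iota 0 (maxn (size la) (size ka))).

Lemma hstripP la ka : reflect
  (forall i, nth 0 la i.+1 <= nth 0 ka i /\ nth 0 ka i <= nth 0 la i)
  (hstrip la ka).
Proof.
apply: (iffP allP) => [H i|H i _]; last by apply/andP.
case: (ltnP i (maxn (size la) (size ka))) => [lt_i|].
  by apply/andP/H; rewrite mem_iota.
rewrite geq_max => /andP[le_la le_ka].
by rewrite !nth_default // leqW.
Qed.

Definition vstrip la ka := all
  (fun i => (nth 0 ka i <= nth 0 la i) && (nth 0 la i <= (nth 0 ka i).+1))
  (iota 0 (maxn (size la) (size ka))).

Lemma vstripP la ka : reflect
  (forall i, nth 0 ka i <= nth 0 la i /\ nth 0 la i <= (nth 0 ka i).+1)
  (vstrip la ka).
Proof.
apply: (iffP allP) => [H i|H i _]; last by apply/andP.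
case: (ltnP i (maxn (size la) (size ka))) => [lt_i|].
  by apply/andP/H; rewrite mem_iota.
rewrite geq_max => /andP[le_la le_ka].
by rewrite !nth_default.
Qed.

Lemma nth_conj_part la j : sorted geq la ->
  nth 0 (conj_part la) j = count (fun i => j < i) la.
Proof.
move=> la_srt; case: (ltnP j (head 0 la)) => [lt_j|le_j].
  by rewrite nth_mkseq.
rewrite nth_default ?size_mkseq //; apply/esym/eqP; rewrite -leqn0 leqNgt -has_count.
apply/hasPn => i /(nthP 0)[k _ <-]; rewrite -leqNgt (leq_trans _ le_j) //.
by rewrite -nth0; apply: sorted_nth_le.
Qed.

(** The rows longer than j form an initial segment, so both sides say that (i, j) is a cell. *)
Lemma sorted_count_gt la i j : sorted geq la ->
  (i < count (fun k => j < k) la) = (j < nth 0 la i).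
Proof.
elim: la i => [|x la IHla] i la_srt /=; first by rewrite nth_nil.
have {}IHla := IHla _ (path_sorted la_srt).
case: (ltnP j x) => [lt_jx|le_xj]; first by case: i => [|i] //=;
  rewrite add1n ltnS IHla.
have -> : count (fun k => j < k) la = 0.
  apply/eqP; rewrite -leqn0 leqNgt IHla -leqNgt.
  exact: leq_trans (sorted_nth_le la_srt (leq0n 1)) le_xj.
rewrite ltn0; apply/esym/negbTE; rewrite -leqNgt.
exact: leq_trans (sorted_nth_le la_srt (leq0n i)) le_xj.
Qed.

(** Transposition swaps the coordinates of a cell. Together with [nat_eq_lt] and [nat_le_lt], this
    is how transposes are compared below. *)
Lemma conj_partP la i j : is_part la ->
  (i < nth 0 (conj_part la) j) = (j < nth 0 la i).
Proof. by move=> /part_sorted srt; rewrite nth_conj_part ?sorted_count_gt. Qed.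

Lemma conj_part_part la : is_part la -> is_part (conj_part la).
Proof.
move=> pla; apply/andP; split.
  apply: mkseq_sorted => i _; apply: sub_count => k; exact: ltnW.
apply/negP => /mapP[j]; rewrite mem_iota add0n => /= lt_j /eqP.
rewrite eq_sym -leqn0 leqNgt sorted_count_gt ?part_sorted //.
by rewrite nth0 lt_j.
Qed.

Lemma nat_eq_lt a b : (forall i, (i < a) = (i < b)) -> a = b.
Proof.
move=> H; apply/eqP; rewrite eqn_leq.
by have := H a; have := H b; rewrite !ltnn; case: ltngtP.
Qed.

Lemma conj_partK la : is_part la -> conj_part (conj_part la) = la.
Proof.
move=> pla; have pcla := conj_part_part pla.
apply: part_eq => // [|i]; first exact: conj_part_part.
by apply: nat_eq_lt => j; rewrite !conj_partP.
Qed.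

Lemma conj_square_parts D la :
  la \in square_parts D -> conj_part la \in square_parts D.
Proof.
case/square_partsP=> pla sla nla; have pc := conj_part_part pla.
have nth_D i : nth 0 (conj_part la) i <= D.
  by rewrite leqNgt conj_partP // nth_default.
apply/square_partsP; split=> //.
by rewrite part_size_le // -leqn0 leqNgt conj_partP // -leqNgt.
Qed.

Lemma sum_ltn D a : a <= D -> \sum_(j < D) (j < a) = a.
Proof.
move=> le_aD; rewrite -big_mkcond (big_ord_narrow le_aD).
by rewrite sum1_card card_ord.
Qed.

(** Double counting of the cells inside a square, by columns and by rows. *)
Lemma sumn_conj_part la : is_part la -> sumn (conj_part la) = sumn la.
Proof.
move=> pla; pose D := sumn la.
have sq : la \in square_parts D by apply: square_parts_sumn.
have /square_partsP[_ sc nc] := conj_square_parts sq.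
have [_ sl nl] := square_partsP _ _ sq.
rewrite (sumn_nth sc) (sumn_nth sl).
rewrite (eq_bigr (fun j : 'I_D => \sum_(i < D) (i < nth 0 (conj_part la) j)));
  last first.
  by move=> j _; rewrite sum_ltn.
rewrite exchange_big /=; apply: eq_bigr => i _; rewrite -[RHS](sum_ltn (nl i)).
by apply: eq_bigr => j _; rewrite conj_partP.
Qed.

Lemma nat_le_lt a b : (forall i, i < a -> i < b) -> a <= b.
Proof. by case: a => // a; apply. Qed.

(** Interlacing means at most one new cell per column; transposed, at most one per row. Each
    inequality is checked cell by cell. *)
Lemma hstrip_conj la ka : is_part la -> is_part ka ->
  hstrip (conj_part la) (conj_part ka) = vstrip la ka.
Proof.
move=> pla pka; apply/hstripP/vstripP => H i; split.
- apply: nat_le_lt => j; rewrite -(conj_partP _ _ pla) -(conj_partP _ _ pka).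
  by move=> lt_i; apply: leq_trans lt_i (H j).2.
- apply: nat_le_lt => -[|j] // lt_j; rewrite ltnS -(conj_partP _ _ pka).
  by apply: leq_trans (H j).1; rewrite conj_partP.
- apply: nat_le_lt => j; rewrite !conj_partP // => lt_i.
  by rewrite -ltnS (leq_trans _ (H j).2).
- apply: nat_le_lt => j; rewrite !conj_partP // => lt_i.
  exact: leq_trans lt_i (H j).1.
Qed.

Lemma dual_partP m la : la \in square_parts m ->
  dual_part m la \in square_parts m /\
  forall i, nth 0 (dual_part m la) i = if i < m then m - nth 0 la (m - i.+1) else 0.
Proof.
case/square_partsP=> pla sla nla.
have [//|add_delta nd] := @part_ofP (fun i => m - nth 0 la (m - i.+1)) m.
  move=> i lt_im; rewrite leq_sub2l // part_nth_le //; lia.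
split=> //; apply/square_partsP; split=> //; first exact: size_part_of.
by move=> i; rewrite -/(part_of _ _) nd; case: ifP => // _; apply: leq_subr.
Qed.

(** The complement consists of the cells (i, j) with (m-1-i, m-1-j) outside [la], a condition
    compatible with exchanging i and j. *)
Lemma dual_conj m la : la \in square_parts m ->
  dual_part m (conj_part la) = conj_part (dual_part m la).
Proof.
move=> sq; have [pla sla nla] := square_partsP _ _ sq.
have csq := conj_square_parts sq; have [_ sc nc] := square_partsP _ _ csq.
have [dsq nd] := dual_partP sq; have [dcsq ndc] := dual_partP csq.
have cdsq := conj_square_parts dsq.
apply: part_eq; [exact: square_parts_part dcsq|exact: square_parts_part cdsq|].
move=> i; apply: nat_eq_lt => j; rewrite conj_partP ?(square_parts_part dsq) //.
rewrite nd ndc; case: (ltnP i m) => lt_im; case: (ltnP j m) => lt_jm //.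
- have Ha := nla (m - j.+1); have Hb := nc (m - i.+1).
  have := conj_partP (m - j.+1) (m - i.+1) pla.
  by set a := nth 0 la _ in Ha *; set b := nth 0 (conj_part la) _ in Hb *; lia.
- by rewrite ltn0; apply/negbTE; rewrite -leqNgt (leq_trans (leq_subr _ _)).
- by rewrite ltn0; apply/esym/negbTE; rewrite -leqNgt (leq_trans (leq_subr _ _)).
Qed.

Lemma nseq_sorted n a : sorted geq (nseq n a).
Proof.
apply/(sortedP 0) => k; rewrite size_nseq => lt_k.
by rewrite !nth_nseq lt_k (ltnW lt_k) /=.
Qed.

Lemma nth_rect a b i : nth 0 (rect a b) i = if i < b then a else 0.
Proof. by rewrite nth_strip ?nth_nseq ?nseq_sorted. Qed.

Lemma rect_part a b : is_part (rect a b).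
Proof. exact/strip_is_part/nseq_sorted. Qed.

Lemma conj_rect a b : conj_part (rect a b) = rect b a.
Proof.
have pr := rect_part a b.
apply: part_eq; [exact: conj_part_part|exact: rect_part|] => i.
apply: nat_eq_lt => j; rewrite conj_partP // !nth_rect.
by case: (ltnP j b); case: (ltnP i a) => ? ?; lia.
Qed.

End Partitions.

(** * Semistandard tableaux *)

Section Tableaux.
Variable R : comNzRingType.
Implicit Types (x : nat -> R) (la ka : seq nat) (n D : nat).

Definition schur_eval x n la : R :=
  \sum_(T : {ffun cell la -> 'I_n} | ssyt T) \prod_(c : cell la) x (T c).

(* A tableau drawn in a D x D box: the value [n] marks the cells outside the
   shape. *)
Record box_ok D n la (B : {ffun 'I_D * 'I_D -> 'I_n.+1}) : Prop := BoxOk {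
  box_shape : forall i j, (B (i, j) < n)%N = (j < nth 0 la i)%N;
  box_row : forall i (j k : 'I_D), (j <= k)%N -> (B (i, j) <= B (i, k))%N;
  box_col : forall (i k : 'I_D) j, (i < k)%N -> (B (k, j) < n)%N ->
    (B (i, j) < B (k, j))%N }.

Definition box_sum D x n la : R :=
  \sum_(B : {ffun 'I_D * 'I_D -> 'I_n.+1} | `[< box_ok la B >])
     \prod_(c | (B c < n)%N) x (B c).

(** The type [cell la] depends on the shape. Drawn in a box, tableaux of all shapes share one type,
    so that a tableau can be compared with what remains after erasing its largest entries. *)
Lemma schur_eval_box D x n la : la \in square_parts D ->
  schur_eval x n la = box_sum D x n la.
Proof.
case/square_partsP => pla sla nla.
pose pos (d : cell la) : 'I_D * 'I_D :=
  (widen_ord sla (tag d), widen_ord (nla (tag d)) (tagged d)).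
have pos_inj : injective pos.
  move=> [i j] [i' j'] [/= /val_inj eq_i]; subst i' => eq_j.
  by congr existT; apply: val_inj.
have posP (i j : 'I_D) : (j < nth 0 la i)%N -> exists d, pos d = (i, j).
  move=> lt_j; have lt_i : (i < size la)%N.
    by rewrite -part_nth_gt0 // (leq_ltn_trans _ lt_j).
  exists (Tagged (fun i : 'I_(size la) => 'I_(nth 0%N la i))
    (Ordinal lt_j : 'I_(nth 0%N la (Ordinal lt_i)))).
  by congr pair; apply: val_inj.
have pos_lt d : ((pos d).2 < nth 0 la (pos d).1)%N by case: d => i j /=.
pose h (T : {ffun cell la -> 'I_n}) : {ffun 'I_D * 'I_D -> 'I_n.+1} :=
  [ffun c => if [pick d | pos d == c] is Some d then widen_ord (leqnSn n) (T d)
             else ord_max].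
have h_pos T d : h T (pos d) = T d :> nat.
  rewrite ffunE; case: pickP => [d' /eqP/pos_inj -> //|/(_ d)].
  by rewrite eqxx.
have h_lt T c : (h T c < n)%N = (c.2 < nth 0 la c.1)%N.
  case: c => i j; apply/idP/idP => [|/posP[d <-]]; last by rewrite h_pos.
  by rewrite ffunE; case: pickP => [d /eqP <- _|_]; rewrite ?pos_lt //= ltnn.
have h_inj : injective h.
  by move=> T T' eq_h; apply/ffunP => d; apply: ord_inj; rewrite -!h_pos eq_h.
have rowE d : cell_row d = (pos d).1 by [].
have colE d : cell_col d = (pos d).2 by [].
have h_ok T : ssyt T <-> box_ok la (h T).
  split => [/forallP ssT | [_ hr hc]].
    split=> [i j|i j k le_jk|i k j lt_ik]; first exact: h_lt.
    - case: (ltnP k (nth 0 la i)) => [lt_k|le_k]; last first.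
        have: ~~ (h T (i, k) < n)%N by rewrite h_lt -leqNgt.
        by rewrite -leqNgt; apply: leq_trans; rewrite -ltnS ltn_ord.
      have [d Ed] := posP _ _ lt_k.
      have [c Ec] := posP _ _ (leq_ltn_trans le_jk lt_k).
      have /forallP/(_ d)/andP[/implyP + _] := ssT c.
      by rewrite -Ed -Ec !h_pos; apply; rewrite !rowE !colE Ed Ec eqxx.
    - rewrite h_lt => lt_k; have [d Ed] := posP _ _ lt_k.
      have lt_i : (j < nth 0 la i)%N.
        by apply: leq_trans lt_k _; apply: part_nth_le (ltnW lt_ik).
      have [c Ec] := posP _ _ lt_i.
      have /forallP/(_ d)/andP[_ /implyP +] := ssT c.
      by rewrite -Ed -Ec !h_pos; apply; rewrite !rowE !colE Ed Ec eqxx.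
  apply/forallP => c; apply/forallP => d; rewrite !rowE !colE -!h_pos.
  move: (pos c) (pos d) (pos_lt d) => [i j] [k l] /= lt_d.
  apply/andP; split; apply/implyP => /andP[/eqP/ord_inj e lt].
    by rewrite e; apply: hr.
  by rewrite e; apply: hc => //; rewrite h_lt.
have h_prod (T : {ffun cell la ->
  'I_n}) : \prod_c x (T c) = \prod_(c | (h T c < n)%N) x (h T c).
  rewrite (eq_bigl (mem (pos @: setT))); last first.
    move=> [i j]; rewrite h_lt; apply/idP/imsetP => [/posP[d <-]|[d _ ->]] //.
    by exists d; rewrite ?inE.
  rewrite big_imset /=; last by move=> ? ? _ _; apply: pos_inj.
  by apply: eq_big => [d|d _]; rewrite ?inE // h_pos.
rewrite /schur_eval (eq_bigr _ (fun T _ => h_prod T)).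
rewrite -(big_imset (fun B : {ffun _ -> _} => \prod_(c | (B c < n)%N) x (B c)) (h := h)
  (A := [pred T | ssyt T])) /=; last by move=> ? ? _ _; apply: h_inj.
apply: eq_bigl => B; apply/imsetP/asboolP => [[T ssT ->]|okB]; first exact/h_ok.
have B_lt d : (B (pos d) < n)%N by rewrite (surjective_pairing (pos d)) (box_shape okB).
pose T : {ffun cell la -> 'I_n} := [ffun d => Ordinal (B_lt d)].
have hB : h T = B.
  apply/ffunP => c; apply: val_inj; rewrite ffunE.
  case: pickP => [d /eqP <-|noc]; first by rewrite /= ffunE.
  apply/eqP; rewrite /= eqn_leq -[X in _ && X]ltnS ltn_ord andbT leqNgt.
  case: c noc => i j noc; rewrite (box_shape okB); apply/negP => /posP[d Ed].
  by have := noc d; rewrite Ed eqxx.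
by exists T => //; rewrite inE; apply/h_ok; rewrite hB.
Qed.

Lemma card_box_shape D la : la \in square_parts D ->
  #|[pred c : 'I_D * 'I_D | c.2 < nth 0 la c.1]%N| = sumn la.
Proof.
case/square_partsP => _ sla nla; rewrite (sumn_nth sla) -sum1_card big_mkcond /=.
transitivity (\sum_(i < D) \sum_(j < D) (j < nth 0 la i) : nat)%N.
  by rewrite pair_bigA /=; apply: eq_bigr => c _; rewrite inE; case: ltnP.
by apply: eq_bigr => i _; rewrite sum_ltn.
Qed.

(** Here the letters are 0, ..., n and the marker is n+1, so [ka] is the shape left after erasing
    the letter n. *)
Definition box_sub D n ka (B : {ffun 'I_D * 'I_D -> 'I_n.+2}) :=
  [forall c, (B c < n)%N == (c.2 < nth 0 ka c.1)%N].

(** The letters below n form an initial segment of each row, whose length is found by [find]. The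
    side [D.+1] makes [inord] available. *)
Lemma box_sub_ex D n la (B : {ffun 'I_D.+1 * 'I_D.+1 -> 'I_n.+2}) :
  la \in square_parts D.+1 -> box_ok la B ->
  exists2 ka, (ka \in square_parts D.+1) && hstrip la ka & box_sub ka B.
Proof.
move=> sq okB; have [pla sla nla] := square_partsP _ _ sq.
pose p i j := (B (inord i, inord j) < n)%N.
pose f i := find (fun j => ~~ p i j) (iota 0 D.+1).
have f_le i : (f i <= D.+1)%N.
  by rewrite -[X in (_ <= X)%N](size_iota 0) find_size.
have fP i j : (j < D.+1)%N -> (j < f i)%N = p i j.
  move=> lt_jD; apply/idP/idP => [lt_j|pij].
    have := before_find 0%N lt_j; rewrite nth_iota // add0n => /negbFE//.
  rewrite ltnNge; apply/negP => le_j.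
  have lt_f : (f i < D.+1)%N by apply: leq_ltn_trans le_j _.
  have : has (fun j => ~~ p i j) (iota 0 D.+1) by rewrite has_find size_iota.
  move/(nth_find 0%N); rewrite nth_iota // add0n => /negP; apply.
  by apply: leq_ltn_trans pij; apply: (box_row okB); rewrite !inordK.
have f_la i : (i < D.+1)%N -> (f i <= nth 0 la i)%N.
  move=> lt_i; apply: nat_le_lt => j lt_j.
  have lt_jD : (j < D.+1)%N by apply: leq_trans lt_j (f_le _).
  move: lt_j; rewrite fP // => pij.
  have := box_shape okB (inord i) (inord j); rewrite !inordK // => <-.
  exact: ltnW.
(* Entries of row i+1 are at most n, so by strictness in the columns the entries above them are
   below n. *)
have la_f i : (i.+1 < D.+1)%N -> (nth 0 la i.+1 <= f i)%N.
  move=> lt_i; apply: nat_le_lt => j lt_j.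
  have lt_jD : (j < D.+1)%N by apply: leq_trans lt_j (nla _).
  rewrite fP //; have := box_shape okB (inord i.+1) (inord j).
  rewrite !inordK // lt_j => lt_B; rewrite /p -ltnS; apply: leq_trans lt_B.
  apply: (box_col okB); first by rewrite !inordK // ltnW.
  have := box_shape okB (inord i.+1) (inord j).
  by rewrite !inordK // lt_j.
have [//|pka nka] := @part_ofP f D.+1.
  by move=> i lt_i; apply: leq_trans (la_f i lt_i); apply: f_la.
exists (part_of f D.+1); last first.
  apply/forallP => -[i j] /=; rewrite nka ltn_ord fP //.
  by rewrite /p !inord_val.
apply/andP; split.
  apply/square_partsP; split=> //; first exact: size_part_of.
  by move=> i; rewrite nka; case: ifP.
apply/hstripP => i; rewrite nka; case: ltnP => lt_i; last first.
  by split=> //; rewrite nth_default // (leq_trans sla) // ltnW.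
split; last exact: f_la.
case: (ltnP i.+1 D.+1) => lt_i1; first exact: la_f.
by rewrite nth_default // (leq_trans sla).
Qed.

Lemma box_sub_inj D n la ka (B : {ffun 'I_D.+1 * 'I_D.+1 -> 'I_n.+2}) ka' :
  ka \in square_parts D.+1 -> ka' \in square_parts D.+1 ->
  box_sub ka B -> box_sub ka' B -> ka = ka'.
Proof.
case/square_partsP=> pka ska nka; case/square_partsP=> pka' ska' nka'.
move=> /forallP sB /forallP sB'; apply: part_eq => // i.
case: (ltnP i D.+1) => lt_i; last first.
  by rewrite !nth_default // (leq_trans _ lt_i).
apply: nat_eq_lt => j; case: (ltnP j D.+1) => lt_j.
  have /eqP := sB (Ordinal lt_i, Ordinal lt_j).
  by have /eqP -> := sB' (Ordinal lt_i, Ordinal lt_j).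
by rewrite !ltnNge (leq_trans (nka _) lt_j) (leq_trans (nka' _) lt_j).
Qed.

(** Filling the cells of [la] outside [ka] with the letter n inverts the erasure. Being a horizontal
    strip is what keeps the columns strict, and every filled cell contributes one factor [x n]. *)
Lemma box_sum_sub D x n la ka :
  la \in square_parts D -> ka \in square_parts D -> hstrip la ka ->
  \sum_(B : {ffun 'I_D * 'I_D -> 'I_n.+2} | `[< box_ok la B >] && box_sub ka B)
     \prod_(c | (B c < n.+1)%N) x (B c)
  = x n ^+ (sumn la - sumn ka) * box_sum D x n ka.
Proof.
move=> sqla sqka /hstripP strip; rewrite /box_sum mulr_sumr.
have [pla sla nla] := square_partsP _ _ sqla.
have [pka ska nka] := square_partsP _ _ sqka.
(* The letter n goes on the strip, and the outer marker moves from n to n+1. *)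
pose f (B : {ffun 'I_D * 'I_D -> 'I_n.+1}) : {ffun 'I_D * 'I_D -> 'I_n.+2} :=
  [ffun c : 'I_D * 'I_D => if (c.2 < nth 0 ka c.1)%N then inord (B c)
             else if (c.2 < nth 0 la c.1)%N then inord n else inord n.+1].
have fE B i j : f B (i, j) = (if (j < nth 0 ka i)%N then B (i, j) : nat
    else if (j < nth 0 la i)%N then n else n.+1) :> nat.
  rewrite ffunE /=; case: ifP => _; last by case: ifP; rewrite inordK.
  by rewrite inordK // (ltn_trans (ltn_ord _)).
have ka_la i j : (j < nth 0 ka i)%N -> (j < nth 0 la i)%N.
  by move=> lt_j; apply: leq_trans lt_j (strip i).2.
apply/esym; apply: (reindex_seq (f := f)); rewrite ?index_enum_uniq //.
- move=> B _ /asboolP okB.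
  have f_lt i j : (f B (i, j) < n.+1)%N = (j < nth 0 la i)%N.
    rewrite fE; case: ifP => lt_j; first by rewrite ltn_ord (ka_la i j).
    by case: ifP; rewrite ?ltnSn // ltnn.
  have f_lt' i j : (f B (i, j) < n)%N = (j < nth 0 ka i)%N.
    rewrite fE; case: ifP => lt_j; first by rewrite (box_shape okB).
    by case: ifP => _; rewrite ?ltnn // ltnNge leqnSn.
  split; first by rewrite mem_index_enum.
    apply/andP; split; last by apply/forallP => -[i j]; rewrite f_lt'.
    apply/asboolP; split=> [|i j k le_jk|i k j lt_ik]; first exact: f_lt.
      rewrite !fE; case: (ltnP k (nth 0 ka i)) => lt_k.
        by rewrite (leq_ltn_trans le_jk lt_k); apply: (box_row okB).
      case: (ltnP k (nth 0 la i)) => lt_k'.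
        rewrite (leq_ltn_trans le_jk lt_k'); case: ifP => _ //.
        by rewrite -ltnS ltn_ord.
      case: ifP => _; first by rewrite ltnW // ltn_ord.
      by case: ifP.
    rewrite f_lt => lt_j.
    (* The cell above a cell of [la] lies in [ka], hence carries a letter below n. *)
    have lt_j' : (j < nth 0 ka i)%N.
      apply: leq_trans lt_j (leq_trans _ (strip i).1).
      exact: part_nth_le.
    rewrite !fE lt_j' lt_j; case: ifP => lt_j''.
      by apply: (box_col okB) => //; rewrite (box_shape okB).
    by rewrite (box_shape okB).
  rewrite [RHS](bigID (fun c : 'I_D * 'I_D => (c.2 < nth 0 ka c.1)%N)) /= [RHS]mulrC.
  congr (_ * _); last first.
    apply: eq_big => [[i j]|[i j]] /=.
      by rewrite f_lt (box_shape okB); case: ltnP => [/ka_la ->|]; rewrite ?andbF.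
    by rewrite (box_shape okB) => lt_j; congr x; rewrite fE lt_j.
  rewrite [RHS](eq_bigr (fun=> x n)); last first.
    move=> [i j]; rewrite f_lt => /andP[lt_j /negbTE /= ge_j].
    by congr x; rewrite fE ge_j lt_j.
  rewrite prodr_const; congr (_ ^+ _).
  rewrite -(card_box_shape sqla) -(card_box_shape sqka).
  rewrite -(cardID [pred c : 'I_D * 'I_D | (c.2 < nth 0 ka c.1)%N]
    [pred c : 'I_D * 'I_D | c.2 < nth 0 la c.1]%N).
  rewrite (_ : #|predI _ _| = #|[pred c : 'I_D * 'I_D | c.2 < nth 0 ka c.1]%N|).
    rewrite addKn; apply: eq_card => -[i j]; rewrite !inE /=.
    by rewrite -topredE /= f_lt andbC.
  apply: eq_card => -[i j]; rewrite !inE /=.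
  by case: (ltnP j (nth 0 ka i)) => [/ka_la ->|]; rewrite ?andbF.
- move=> B B' _ _ /asboolP okB /asboolP okB' eq_f; apply/ffunP => -[i j].
  apply: ord_inj; case: (ltnP j (nth 0 ka i)) => lt_j.
    by have := fE B i j; have := fE B' i j; rewrite lt_j eq_f => <- <-.
  have B_top (C : {ffun 'I_D * 'I_D -> 'I_n.+1}) : box_ok ka C -> C (i, j) = n :> nat.
    move=> okC; apply/eqP; rewrite eqn_leq -ltnS ltn_ord leqNgt.
    by rewrite (box_shape okC) -leqNgt.
  by rewrite !B_top.
move=> C _ /andP[/asboolP okC /forallP subC].
(* Truncating at n merges the letter n and the marker n+1 into the marker n of the smaller
   alphabet. *)
pose B : {ffun 'I_D * 'I_D -> 'I_n.+1} := [ffun c => inord (minn (C c) n)].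
have BE c : B c = minn (C c) n :> nat by rewrite ffunE inordK // ltnS geq_minr.
have C_lt i j : (C (i, j) < n)%N = (j < nth 0 ka i)%N by have /eqP := subC (i, j).
exists B.
  rewrite mem_index_enum /=; apply/asboolP; split=> [i j|i j k le_jk|i k j lt_ik].
  - by rewrite BE -C_lt gtn_min ltnn orbF.
  - by rewrite !BE leq_min geq_minr andbT geq_min (box_row okC i le_jk).
  rewrite !BE gtn_min ltnn orbF => lt_n.
  have lt_C : (C (i, j) < C (k, j))%N by apply: (box_col okC) => //; apply: ltnW.
  by rewrite leq_min !gtn_min lt_C (ltn_trans lt_C lt_n).
apply/ffunP => -[i j]; apply: ord_inj; rewrite fE BE -C_lt -(box_shape okC).
case: ltnP => [/ltnW/minn_idPl //|le_n]; case: ltnP => [|lt_n].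
  by rewrite ltnS => le_n'; apply/eqP; rewrite eqn_leq le_n.
by apply/eqP; rewrite eqn_leq lt_n -ltnS ltn_ord.
Qed.

Lemma box_sum_branch D x n la : la \in square_parts D.+1 ->
  box_sum D.+1 x n.+1 la = \sum_(ka <- square_parts D.+1 | hstrip la ka)
    x n ^+ (sumn la - sumn ka) * box_sum D.+1 x n ka.
Proof.
move=> sqla; rewrite /box_sum.
transitivity (\sum_(B : {ffun 'I_D.+1 * 'I_D.+1 -> 'I_n.+2} | `[< box_ok la B >])
  \sum_(ka <- square_parts D.+1 | hstrip la ka && box_sub ka B)
    \prod_(c | (B c < n.+1)%N) x (B c)).
  apply: eq_bigr => B /asboolP okB.
  have [ka0 /andP[sq0 strip0] sub0] := box_sub_ex sqla okB.
  rewrite -[RHS]big_filter (_ : [seq ka <- _ | _] = [:: ka0]) ?big_seq1 //.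
  apply: perm_small_eq => //; apply: uniq_perm => //.
    exact/filter_uniq/square_parts_uniq.
  move=> ka; rewrite mem_filter inE; apply/andP/eqP => [[/andP[_ sub] sq]|->].
    exact: box_sub_inj sub sub0.
  by rewrite strip0.
rewrite (exchange_big_dep (hstrip la)) /=; last by move=> B ka _ /andP[].
rewrite big_seq_cond [RHS]big_seq_cond; apply: eq_bigr => ka /andP[sqka strip].
rewrite -box_sum_sub //; apply: eq_bigl => B; by rewrite strip.
Qed.

(** Every [ka] in such a sum is contained in [la], so any square containing [la] gives the same
    sum. *)
Lemma sum_hstrip_square (V : nmodType) D D' la (F : seq nat -> V) :
  la \in square_parts D -> la \in square_parts D' ->
  \sum_(ka <- square_parts D | hstrip la ka) F ka
  = \sum_(ka <- square_parts D' | hstrip la ka) F ka.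
Proof.
have sub E E' ka : la \in square_parts E -> la \in square_parts E' ->
    ka \in square_parts E -> hstrip la ka -> ka \in square_parts E'.
  case/square_partsP=> pla sla nla; case/square_partsP=> _ sla' nla'.
  case/square_partsP=> pka ska nka /hstripP strip.
  apply/square_partsP; split=> //; last by move=> i; apply: leq_trans (strip i).2 _.
  rewrite part_size_le // -leqn0; apply: leq_trans (strip E').2 _.
  by rewrite nth_default.
move=> sq sq'; apply: (reindex_seq (f := id)); rewrite ?square_parts_uniq //.
  by move=> ka sqka strip; rewrite (sub D D').
by move=> ka sqka strip; exists ka; rewrite // strip andbT (sub D' D).
Qed.

(** Tableaux are grouped by the shape of their letters below n. Inductions on the number of
    variables rest on this recursion. *)
Lemma schur_eval_branch D x n la : la \in square_parts D ->
  schur_eval x n.+1 la = \sum_(ka <- square_parts D | hstrip la ka)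
    x n ^+ (sumn la - sumn ka) * schur_eval x n ka.
Proof.
move=> sq; have sq' : la \in square_parts D.+1 by apply: square_parts_sub sq.
rewrite (sum_hstrip_square _ sq sq') (schur_eval_box _ _ sq') (box_sum_branch _ _ sq').
rewrite big_seq_cond [RHS]big_seq_cond; apply: eq_bigr => ka /andP[sqka _].
by rewrite (schur_eval_box _ _ sqka).
Qed.
End Tableaux.

(** * Alternants *)

(* The exponent vector la + delta, with delta = (n - 1, ..., 1, 0). *)
Definition add_delta n la j : nat := (nth 0 la j + (n - j.+1))%N.

Section Alternants.
Variable R : comNzRingType.
Implicit Types (x : nat -> R) (la ka : seq nat) (n D : nat).

Definition alt x n (g : nat -> nat) : R :=
  \det (\matrix_(i < n, j < n) x i ^+ g j).

Lemma eq_alt x y n g h : {in gtn n, x =1 y} -> {in gtn n, g =1 h} ->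
  alt x n g = alt y n h.
Proof.
move=> eq_xy eq_gh; congr (\det _); apply/matrixP => i j; rewrite !mxE.
by rewrite eq_xy ?eq_gh // inE.
Qed.

(** Multilinearity in the columns: [a] does not depend on the row and leaves the determinant.
    Transposing makes the Leibniz product run over columns. *)
Lemma det_sum_col n M (P : 'I_n -> pred 'I_M) (a : 'I_n -> 'I_M -> R)
    (B : 'I_n -> 'I_n -> 'I_M -> R) :
  \det (\matrix_(i < n, j < n) \sum_(p | P j p) a j p * B i j p)
  = \sum_(f in family P) (\prod_j a j (f j)) * \det (\matrix_(i, j) B i j (f j)).
Proof.
rewrite -det_tr; transitivity (\sum_(s : 'S_n) (-1) ^+ s *
    \sum_(f in family P) \prod_j (a j (f j) * B (s j) j (f j))).
  apply: eq_bigr => s _; congr (_ * _).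
  rewrite -(bigA_distr_big_dep _ (fun i j => a i j * B (s i) i j)).
  by apply: eq_bigr => j _; rewrite !mxE.
under eq_bigr do rewrite mulr_sumr.
rewrite exchange_big /=; apply: eq_bigr => f _.
rewrite -det_tr /determinant mulr_sumr; apply: eq_bigr => s _.
rewrite big_split /= mulrCA; congr (_ * (_ * _)).
by apply: eq_bigr => j _; rewrite !mxE.
Qed.

(** With t = x n, subtract t^(l j - l (j+1)) times column j+1 from column j. The last row then
    vanishes except in the last column, and in row i the factor x i - t splits off, leaving a
    geometric sum. *)
Lemma alt_col_op x n l : (forall j, (j < n)%N -> (l j.+1 <= l j)%N) ->
  alt x n.+1 l = x n ^+ l n * (\prod_(i < n) (x i - x n) *
    \det (\matrix_(i < n, j < n) \sum_(p < l j - l j.+1)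
            x n ^+ (l j - l j.+1 - p.+1) * x i ^+ (l j.+1 + p))).
Proof.
move=> lP; set t := x n.
(* The column operations as a unitriangular matrix, of determinant 1. *)
pose U := \matrix_(k < n.+1, j < n.+1) ((k == j)%:R
  - (k == j.+1 :> nat)%:R * t ^+ (l j - l k)) : 'M[R]_n.+1.
have detU : \det U = 1.
  rewrite det_trig; last first.
    apply/is_trig_mxP => k j lt_kj; rewrite mxE.
    rewrite (_ : (k == j) = false); last by apply/eqP => e; rewrite e ltnn in lt_kj.
    rewrite (_ : (k == j.+1 :> nat) = false) ?mul0r ?subr0 //.
    by apply/eqP; lia.
  rewrite big1 // => k _; rewrite mxE eqxx.
  rewrite (_ : (k == k.+1 :> nat) = false) ?mul0r ?subr0 //.
  by apply/eqP; lia.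
pose M := \matrix_(i < n.+1, j < n.+1) x i ^+ l j.
have MU i j : (M *m U) i j =
    x i ^+ l j - (if (j < n)%N then t ^+ (l j - l j.+1) * x i ^+ l j.+1 else 0).
  rewrite !mxE; under eq_bigr do rewrite !mxE mulrBr.
  rewrite sumrB; congr (_ - _).
    rewrite (bigD1 j) //= eqxx mulr1 big1 ?addr0 // => k /negbTE ->.
    by rewrite mulr0.
  case: ltnP => lt_j; last first.
    rewrite big1 // => k _; rewrite (_ : (k == j.+1 :> nat) = false) ?mul0r ?mulr0 //.
    by apply/eqP; have := ltn_ord k; lia.
  rewrite (bigD1 (Ordinal (lt_j : j.+1 < n.+1)%N)) //= eqxx mul1r big1 ?addr0.
    exact: mulrC.
  move=> k /negbTE ne; rewrite (_ : (k == j.+1 :> nat) = false) ?mul0r ?mulr0 //.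
rewrite /alt -/M; transitivity (\det (M *m U)).
  by rewrite det_mulmx detU mulr1.
rewrite (expand_det_row _ ord_max) (bigD1 ord_max) //= big1 ?addr0; last first.
  move=> j ne_j; rewrite MU /= -/t.
  have lt_j : (j < n)%N.
    rewrite ltn_neqAle -ltnS ltn_ord andbT; apply: contraNneq ne_j => e.
    exact/eqP/ord_inj.
  by rewrite lt_j -exprD subnK ?lP // subrr mul0r.
rewrite MU /= ltnn subr0; congr (_ * _).
rewrite /cofactor -signr_odd addnn odd_double expr0 mul1r.
have -> : row' ord_max (col' ord_max (M *m U)) =
    diag_mx (\row_(i < n) (x i - t)) *m
    \matrix_(i < n, j < n) \sum_(p < l j - l j.+1)
            t ^+ (l j - l j.+1 - p.+1) * x i ^+ (l j.+1 + p).
  apply/matrixP => i j; rewrite mul_diag_mx [LHS]mxE [LHS]mxE MU !mxE.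
  rewrite !lift_max ltn_ord.
  have -> : x i ^+ l j = x i ^+ (l j - l j.+1) * x i ^+ l j.+1.
    by rewrite -exprD subnK // lP.
  rewrite -mulrBl -opprB subrXX -mulNr opprB -mulrA; congr (_ * _).
  rewrite mulr_suml; apply: eq_bigr => p _.
  by rewrite -mulrA -exprD addnC; congr (_ ^+ _ * _); lia.
rewrite det_mulmx det_diag; congr (_ * _).
by apply: eq_bigr => i _; rewrite mxE.
Qed.

Lemma alt_branch D x n la : la \in square_parts D -> (size la <= n.+1)%N ->
  alt x n.+1 (add_delta n.+1 la) = \prod_(i < n) (x i - x n) *
    \sum_(ka <- square_parts D | hstrip la ka && (size ka <= n)%N)
      x n ^+ (sumn la - sumn ka) * alt x n (add_delta n ka).
Proof.
case/square_partsP => pla sla nla le_la.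
have nth_le j : (nth 0 la j.+1 <= nth 0 la j)%N by apply: part_nth_le.
rewrite alt_col_op; last first.
  by move=> j lt_j; rewrite /add_delta leq_add // !subSS leq_sub2l // leqnSn.
rewrite mulrCA; congr (_ * _).
rewrite (_ : add_delta n.+1 la n = nth 0 la n); last by rewrite /add_delta subnn addn0.
pose d j := (nth 0 la j - nth 0 la j.+1)%N.
have pdE (j : 'I_n) : (add_delta n.+1 la j - add_delta n.+1 la j.+1 = (d j).+1)%N.
  by rewrite /add_delta /d; have := nth_le j; have := ltn_ord j; lia.
pose P (j : 'I_n) : pred 'I_D.+1 := [pred p : 'I_D.+1 | (p <= d j)%N].
have d_le j : (d j <= D)%N by apply: leq_trans (leq_subr _ _) (nla _).
pose a (j : 'I_n) (p : 'I_D.+1) := x n ^+ (d j - p).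
pose B (i j : 'I_n) (p : 'I_D.+1) := x i ^+ (add_delta n.+1 la j.+1 + p).
have -> : \matrix_(i < n, j < n) \sum_(p < add_delta n.+1 la j - add_delta n.+1 la j.+1)
    x n ^+ (add_delta n.+1 la j - add_delta n.+1 la j.+1 - p.+1) *
      x i ^+ (add_delta n.+1 la j.+1 + p)
  = \matrix_(i < n, j < n) \sum_(p | P j p) a j p * B i j p.
  apply/matrixP => i j; rewrite !mxE pdE.
  rewrite (big_ord_widen_cond D.+1 xpredT
    (fun p => x n ^+ ((d j).+1 - p.+1) * x i ^+ (add_delta n.+1 la j.+1 + p))) ?ltnS //.
rewrite det_sum_col mulr_sumr.
pose g (f : {ffun 'I_n -> 'I_D.+1}) j : nat := if insub j is Some j' then f j' else 0%N.
have gE f (j : 'I_n) : g f j = f j by rewrite /g valK.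
pose ka f := part_of (fun j => nth 0 la j.+1 + g f j)%N n.
have kaP f : f \in family P -> is_part (ka f) /\
    (forall j : 'I_n, nth 0 (ka f) j = nth 0 la j.+1 + f j)%N.
  move=> /familyP fP.
  have [i lt_i|pka nka] := @part_ofP (fun j => nth 0 la j.+1 + g f j)%N n.
    apply: leq_trans (leq_addr _ _); rewrite (gE f (Ordinal lt_i)).
    by have := fP (Ordinal lt_i); rewrite inE /d /= => H; have := nth_le i.+1; lia.
  by split=> // j; rewrite nka ltn_ord gE.
have ka_size f : (size (ka f) <= n)%N by apply: size_part_of.
have ka_nth f i : (n <= i)%N -> nth 0%N (ka f) i = 0%N.
  by move=> le_ni; rewrite nth_default // (leq_trans (ka_size f)).
apply: (reindex_seq (f := ka)); rewrite ?index_enum_uniq ?square_parts_uniq //.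
- move=> f _ Pf; have [pka nka] := kaP f Pf; move/familyP: Pf => fP.
  have f_le j : (f j <= d j)%N by have := fP j.
  have strip i : (nth 0 la i.+1 <= nth 0 (ka f) i)%N /\ (nth 0 (ka f) i <= nth 0 la
    i)%N.
    case: (ltnP i n) => lt_i.
      rewrite (nka (Ordinal lt_i)) /= leq_addr; split=> //.
      by have := f_le (Ordinal lt_i); rewrite /d /=; have := nth_le i; lia.
    by rewrite ka_nth // nth_default // (leq_trans le_la).
  split.
  - apply/square_partsP; split=> // [|i]; last exact: leq_trans (strip i).2 (nla i).
    rewrite part_size_le // -leqn0; apply: leq_trans (strip D).2 _.
    by rewrite nth_default.
  - by rewrite ka_size andbT; apply/hstripP.
  rewrite mulrA; congr (_ * _); last first.
    congr (\det _); apply/matrixP => i j; rewrite !mxE /B /add_delta nka.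
    by congr (_ ^+ _); rewrite subSS addnAC.
  rewrite /a prodrXr -exprD; congr (_ ^+ _).
  rewrite (sumn_nth le_la) (sumn_nth (ka_size f)) big_ord_recr /= addnC.
  rewrite -addnBAC; last by apply: leq_sum => j _; apply: (strip j).2.
  rewrite -sumnB; last by move=> j _; apply: (strip j).2.
  by congr (_ + _)%N; apply: eq_bigr => j _; rewrite nka /d subnDA.
- move=> f f' _ _ Pf Pf' eq_ka; apply/ffunP => j; apply: ord_inj.
  have [_ nf] := kaP f Pf; have [_ ng] := kaP f' Pf'.
  by have := nf j; rewrite eq_ka ng => /addnI.
move=> mu /square_partsP[pmu smu nmu] /andP[/hstripP strip le_mu].
(* The term chosen in column j is recovered as mu_j - la_(j+1). *)
pose f : {ffun 'I_n -> 'I_D.+1} := [ffun j :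
  'I_n => inord (nth 0 mu j - nth 0 la j.+1)%N].
have fE (j : 'I_n) : f j = (nth 0 mu j - nth 0 la j.+1)%N :> nat.
  by rewrite ffunE inordK // ltnS (leq_trans (leq_subr _ _)).
have Pf : f \in family P.
  by apply/familyP => j; rewrite inE fE /d leq_sub2r // (strip j).2.
exists f; first by rewrite mem_index_enum.
have [pka nka] := kaP f Pf; apply: part_eq => // i; case: (ltnP i n) => lt_i.
  by rewrite (nka (Ordinal lt_i)) fE /= subnKC // (strip i).1.
by rewrite ka_nth // nth_default // (leq_trans le_mu).
Qed.

Lemma sum_hstrip_size (V : nmodType) D n la (F : seq nat -> V) :
  (forall ka, is_part ka -> (n < size ka)%N -> F ka = 0) ->
  \sum_(ka <- square_parts D | hstrip la ka) F ka
  = \sum_(ka <- square_parts D | hstrip la ka && (size ka <= n)%N) F ka.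
Proof.
move=> F0; rewrite -[in RHS]big_filter_cond -[LHS]big_filter [LHS]big_seq.
rewrite [RHS]big_seq_cond.
rewrite (bigID (fun ka => (size ka <= n)%N)) /= [X in _ + X]big1 ?addr0 //.
move=> ka /andP[]; rewrite mem_filter => /andP[_ /square_parts_part pka].
by rewrite -ltnNge; apply: F0.
Qed.

Lemma schur_eval_nil x n : schur_eval x n [::] = 1.
Proof.
rewrite /schur_eval; have no_cell (c : cell [::]) : False by case: c => -[].
rewrite (big_pred1 [ffun c : cell [::] => match no_cell c return 'I_n with end]).
  by rewrite big1 // => c; case: (no_cell c).
move=> T /=; rewrite [RHS](_ : _ = true); first by apply/forallP => c;
  case: (no_cell c).
by apply/eqP/ffunP => c; case: (no_cell c).
Qed.

Lemma schur_eval0_eq0 x la : is_part la -> (0 < size la)%N -> schur_eval x 0 la = 0.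
Proof.
move=> pla la0; rewrite /schur_eval big1 // => T _.
have la0' : (0 < nth 0 la (Ordinal la0))%N by rewrite part_nth_gt0.
by case: (T (Tagged (fun i : 'I_(size la) => 'I_(nth 0%N la i)) (Ordinal la0'))).
Qed.

(** Removing a horizontal strip shortens a column by at most one, so too many rows remain at each
    step of the branching. *)
Lemma schur_eval_eq0 x n la : is_part la -> (n < size la)%N -> schur_eval x n la = 0.
Proof.
elim: n la => [|n IHn] la pla lt_n; first exact: schur_eval0_eq0.
rewrite (@schur_eval_branch _ (sumn la)) ?square_parts_sumn //.
rewrite big_seq_cond big1 // => ka /andP[/square_parts_part pka /hstripP strip].
rewrite IHn ?mulr0 // -part_nth_gt0 //.
by apply: leq_trans (strip n).1; rewrite part_nth_gt0.
Qed.

Lemma square_parts0 : square_parts 0 = [:: [::]].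
Proof.
apply: perm_small_eq => //; apply: uniq_perm (square_parts_uniq 0) _ _ => // la.
rewrite mem_square_parts inE; apply/and3P/eqP => [[_]|->] //.
by rewrite leqn0 => /nilP.
Qed.

(** Tableaux and alternants branch along the same strips with the same powers of the last variable.
    The extra factor of the alternants is common to [la] and to the empty partition. *)
Lemma bialternant x n la : is_part la -> (size la <= n)%N ->
  alt x n (add_delta n [::]) * schur_eval x n la = alt x n (add_delta n la).
Proof.
elim: n la => [|n IHn] la pla le_la.
  have -> : la = [::] by case: la le_la {pla}.
  by rewrite schur_eval_nil mulr1.
have sq : la \in square_parts (sumn la) by apply: square_parts_sumn.
rewrite (alt_branch _ sq le_la) (schur_eval_branch _ _ sq).
rewrite (@sum_hstrip_size _ _ n); last by move=> ka pka ?;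
  rewrite schur_eval_eq0 ?mulr0.
(* For the empty partition the branching has a single term and peels the factors with the last
   variable off the Vandermonde determinant. *)
rewrite (@alt_branch 0) //; last by rewrite mem_square_parts.
rewrite -mulrA; congr (_ * _).
have -> : \sum_(ka <- square_parts 0 | hstrip [::] ka && (size ka <= n)%N)
    x n ^+ (sumn [::] - sumn ka) * alt x n (add_delta n ka) =
      alt x n (add_delta n [::]).
  by rewrite square_parts0 big_mkcond big_seq1 /= expr0 mul1r.
rewrite mulr_sumr big_seq_cond [RHS]big_seq_cond; apply: eq_bigr => ka.
case/andP=> /square_parts_part pka /andP[_ le_ka].
by rewrite mulrCA IHn.
Qed.
End Alternants.

(** * Alternating coefficients *)

Lemma rmorph_alt (R S : comNzRingType) (phi : {rmorphism R -> S}) x n g :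
  phi (alt x n g) = alt (fun i => phi (x i)) n g.
Proof.
rewrite /alt -det_map_mx; congr (\det _); apply/matrixP => i j.
by rewrite !mxE rmorphXn.
Qed.

Lemma rmorph_schur_eval (R S : comNzRingType) (phi : {rmorphism R -> S}) x n la :
  phi (schur_eval x n la) = schur_eval (fun i => phi (x i)) n la.
Proof.
rewrite /schur_eval rmorph_sum; apply: eq_bigr => T _.
by rewrite rmorph_prod.
Qed.

Lemma eq_schur_eval (R : comNzRingType) (x y : nat -> R) n la :
  {in gtn n, x =1 y} -> schur_eval x n la = schur_eval y n la.
Proof.
move=> eq_xy; apply: eq_bigr => T _; apply: eq_bigr => c _.
by rewrite eq_xy // inE.
Qed.

(** The default 0 matters: [mvar n n] is the image of the last of n+1 variables under
    [kill_last]. *)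
Definition mvar n (i : nat) : {mpoly int[n]} :=
  if insub i is Some k then 'X_(k : 'I_n) else 0.

Lemma mvarE n (i : 'I_n) : mvar n i = 'X_i. Proof. by rewrite /mvar valK. Qed.

Lemma schurE la n : schur la n = schur_eval (mvar n) n la.
Proof.
by apply: eq_bigr => T _; apply: eq_bigr => c _; rewrite mvarE.
Qed.

Definition mnm_of n (g : nat -> nat) : 'X_{1..n} := [multinom g i | i < n].

Definition mnm_perm n (m : 'X_{1..n}) (s : 'S_n) :
  'X_{1..n} := [multinom m (s i) | i < n].

Lemma mnm_permE n (m : 'X_{1..n}) s i : mnm_perm m s i = m (s i).
Proof. exact: mnmE. Qed.

Lemma mcoeff_Xmul n m (p : {mpoly int[n]}) M :
  ('X_[m] * p)@_M = if (m <= M)%MM then p@_(M - m) else 0.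
Proof.
case: ifPn => [le_mM|nle]; first by rewrite mulrC -{1}(submK le_mM) addmC mcoeffMX.
rewrite mcoeffM big1 // => k /eqP eM; rewrite mcoeffX; case: eqP => [e|_].
  by case/negP: nle; rewrite eM -e lem_addr.
by rewrite mul0r.
Qed.

Lemma alt_sum n g : alt (mvar n) n g =
  \sum_(s : 'S_n) (-1) ^+ s *: 'X_[mnm_perm (mnm_of n g) s].
Proof.
rewrite /alt; apply: eq_bigr => s _.
rewrite -mul_mpolyC rmorphXn rmorphN1; congr (_ * _).
by rewrite mpolyXE_id; apply: eq_bigr => i _; rewrite !mxE !mnmE mvarE.
Qed.

Lemma coef_altM n g (p : {mpoly int[n]}) M : (alt (mvar n) n g * p)@_M
  = \sum_(s : 'S_n) (-1) ^+ s * (if (mnm_perm (mnm_of n g) s <= M)%MM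
      then p@_(M - mnm_perm (mnm_of n g) s) else 0).
Proof.
rewrite alt_sum mulr_suml raddf_sum /=; apply: eq_bigr => s _.
by rewrite -scalerAl mcoeffZ mcoeff_Xmul.
Qed.

Lemma msym_alt n g s : msym s (alt (mvar n) n g) = (-1) ^+ s * alt (mvar n) n g.
Proof.
rewrite alt_sum raddf_sum mulr_sumr /= (reindex_inj (mulgI s)) /=.
apply: eq_bigr => t _; rewrite msymZ msymX odd_permM signr_addb.
rewrite -!mul_mpolyC rmorphM !rmorphXn rmorphN1 /= mulrA; congr (_ * 'X_[_]).
by apply/mnmP => i; rewrite !mnmE permM permKV.
Qed.

(** An increasing permutation moves no index down, and neither does its inverse. *)
Lemma increasing_perm1 n (s : 'S_n) : {mono s : i j / ((i : 'I_n) < j)%N} -> s = 1%g.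
Proof.
have le_id (t : 'S_n) : {mono t : i j / ((i : 'I_n) < j)%N} ->
  forall i : 'I_n, (i <= t i)%N.
  move=> mt [i lt_i]; elim: i lt_i => //= i IHi lt_i.
  apply: leq_ltn_trans (IHi (ltnW lt_i)) _.
  by rewrite mt.
move=> ms; apply/permP => i; apply: ord_inj; rewrite perm1.
apply/eqP; rewrite eqn_leq le_id // andbT leqNgt.
have ms' : {mono (s^-1)%g : i j / ((i : 'I_n) < j)%N}.
  by move=> j k; rewrite -ms !permKV.
by rewrite -ms' permK -leqNgt le_id.
Qed.

Definition sdecreasing n (m : 'X_{1..n}) := forall i j : 'I_n, (i < j)%N ->
  (m j < m i)%N.

Lemma sdecreasing_lt n (m : 'X_{1..n}) : sdecreasing m ->
  forall i j, (m j < m i)%N = (i < j)%N.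
Proof.
move=> sm i j; case: (ltngtP i j) => [/sm //|/sm|/ord_inj ->]; last by rewrite ltnn.
by move=> lt_m; apply/negbTE; rewrite -leqNgt ltnW.
Qed.

Lemma add_delta_sdecreasing n la : is_part la ->
  sdecreasing (mnm_of n (add_delta n la)).
Proof.
move=> pla i j lt_ij; rewrite !mnmE /add_delta -addnS leq_add //.
  exact: part_nth_le (ltnW lt_ij).
by have := ltn_ord j; lia.
Qed.

Lemma add_delta_inj n la mu : is_part la -> is_part mu ->
  (size la <= n)%N -> (size mu <= n)%N ->
  mnm_of n (add_delta n la) = mnm_of n (add_delta n mu) -> la = mu.
Proof.
move=> pla pmu sla smu /mnmP eq_pd; apply: part_eq => // i.
case: (ltnP i n) => [lt_i|le_i]; last first.
  by rewrite !nth_default // (leq_trans _ le_i).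
by have := eq_pd (Ordinal lt_i); rewrite !mnmE => /addIn.
Qed.

Lemma sdecreasing_part n (m : 'X_{1..n}) : sdecreasing m ->
  exists ka, [/\ is_part ka, (size ka <= n)%N & m = mnm_of n (add_delta n ka)].
Proof.
move=> sm.
have sm1 i : (i.+1 < n)%N -> (nth 0 m i.+1 < nth 0 m i)%N.
  move=> lt_i; have := sm (Ordinal (ltnW lt_i)) (Ordinal lt_i) (ltnSn i).
  by rewrite !(mnm_nth 0).
(* The entry k places before the last is at least k, so subtracting delta below is never
   truncated. *)
have ge_m k : (k < n)%N -> (k <= nth 0 m (n - k.+1))%N.
  elim: k => // k IHk lt_k; apply: leq_ltn_trans (IHk (ltnW lt_k)) _.
  have := sm1 (n - k.+2)%N; rewrite (_ : (n - k.+2).+1 = n - k.+1)%N; last lia.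
  by apply; lia.
have [i lt_i|pka nka] := @part_ofP (fun i => nth 0 m i - (n - i.+1))%N n.
  by have := sm1 i lt_i; lia.
exists (part_of (fun i => nth 0 m i - (n - i.+1))%N n).
split=> //; first exact: size_part_of.
apply/mnmP => i; rewrite !mnmE /add_delta nka ltn_ord (mnm_nth 0) subnK //.
have := ge_m (n - i.+1)%N; rewrite (_ : n - (n - i.+1).+1 = i)%N; last first.
  by have := ltn_ord i; lia.
by apply; have := ltn_ord i; lia.
Qed.

(** A permutation carrying one strictly decreasing exponent vector to another is increasing, so only
    the identity contributes. *)
Lemma coef_alt n la mu : is_part la -> is_part mu ->
  (size la <= n)%N -> (size mu <= n)%N ->
  (alt (mvar n) n (add_delta n la))@_(mnm_of n (add_delta n mu)) = (la == mu)%:R.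
Proof.
move=> pla pmu sla smu; rewrite -[alt _ _ _]mulr1 coef_altM (bigD1 1%g) //=.
rewrite [X in _ + X]big1 ?addr0.
  rewrite odd_perm1 expr0 mul1r.
  have -> : mnm_perm (mnm_of n (add_delta n la)) 1 = mnm_of n (add_delta n la).
    by apply/mnmP => i; rewrite !mnmE perm1.
  case: eqP => [->|ne]; first by rewrite lepm_refl mcoeff1 -{1}(add0m (mnm_of _ _))
    addmK eqxx.
  case: ifP => // le_m; rewrite mcoeff1; case: eqP => // e.
  case: ne; apply: (@add_delta_inj n) => //.
  by rewrite -(submK le_m) e add0m.
move=> s ne_s; case: ifP => [le_m|]; rewrite ?mulr0 // mcoeff1; case: eqP => e;
  rewrite ?mulr0 //.
case/eqP: ne_s; apply: increasing_perm1 => i j.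
have em : mnm_perm (mnm_of n (add_delta n la)) s = mnm_of n (add_delta n mu).
  by rewrite -(submK le_m) e add0m.
have := sdecreasing_lt (@add_delta_sdecreasing n _ pmu) i j.
by rewrite -em !mnm_permE (sdecreasing_lt (@add_delta_sdecreasing n _ pla)).
Qed.

Definition alternating n (F : 'X_{1..n} -> int) :=
  forall (s : 'S_n) m, F (mnm_perm m s) = (-1) ^+ s * F m.

Lemma alternating_altM n g (p : {mpoly int[n]}) : p \is symmetric ->
  alternating (fun m => (alt (mvar n) n g * p)@_m).
Proof.
move=> /issymP sp s m; rewrite -[LHS]mcoeff_sym msymM msym_alt sp -mulrA.
by case: (odd_perm s); rewrite ?expr0 ?mul1r // expr1 !mulN1r mcoeffN.
Qed.

(** Exchanging the two equal exponents gives F m = - F m. *)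
Lemma alternating_noninj n (F : 'X_{1..n} -> int) (i j : 'I_n) (m : 'X_{1..n}) :
  alternating F -> i != j -> m i = m j -> F m = 0.
Proof.
move=> aF ne_ij eq_m; have := aF (tperm i j) m.
have -> : mnm_perm m (tperm i j) = m.
  by apply/mnmP => k; rewrite mnmE; case: tpermP => [->|->|].
by rewrite odd_tperm ne_ij expr1 mulN1r; lia.
Qed.

(** A vector without repeated exponents can be sorted, at the cost of a sign. *)
Lemma alternating_eq0 n (F : 'X_{1..n} -> int) : alternating F ->
  (forall m, sdecreasing m -> F m = 0) -> forall m, F m = 0.
Proof.
move=> aF F0 m; case: (boolP (uniq (val m))) => [um|]; last first.
  move=> /(uniqPn 0)[i [j [lt_ij lt_j eq_m]]]; rewrite size_tuple in lt_j.
  apply: (@alternating_noninj n F (Ordinal (ltn_trans lt_ij lt_j)) (Ordinal lt_j))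
    => //.
    by apply/eqP => -[e]; rewrite e ltnn in lt_ij.
  by rewrite !(mnm_nth 0).
have geqT : total geq by move=> a b; apply: leq_total.
have /tuple_permP[s es] : perm_eq (sort geq (val m)) (val m) by rewrite perm_sort.
have eqm : val (mnm_perm m s) = sort geq (val m) :> seq nat.
  rewrite es; apply: eq_map => i; exact: (erefl _).
have : F (mnm_perm m s) = 0.
  apply: F0 => i j lt_ij; rewrite !(mnm_nth 0) eqm.
  have srt := sort_sorted geqT (val m).
  rewrite ltn_neqAle (sorted_nth_le srt (ltnW lt_ij)) andbT nth_uniq ?sort_uniq //.
  - by rewrite neq_ltn lt_ij orbT.
  - by rewrite size_sort size_tuple.
  - by rewrite size_sort size_tuple.
by rewrite aF => /eqP; rewrite mulf_eq0 signr_eq0 => /eqP.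
Qed.

(** * Coefficients in the Schur basis *)

(** By [bialternant] this extracts the coefficient of s_nu from a symmetric polynomial, for [nu] of
    at most n rows. *)
Definition alt_coef n nu (p : {mpoly int[n]}) : int :=
  (alt (mvar n) n (add_delta n [::]) * p)@_(mnm_of n (add_delta n nu)).

Lemma alt_coef_is_additive n nu : additive (@alt_coef n nu).
Proof. by move=> p q; rewrite /alt_coef mulrBr mcoeffB. Qed.

HB.instance Definition _ n nu :=
  GRing.isAdditive.Build {mpoly int[n]} int (@alt_coef n nu) (@alt_coef_is_additive
    n nu).

Lemma alt_delta_neq0 n : alt (mvar n) n (add_delta n [::]) != 0.
Proof.
apply/eqP => /(congr1 (mcoeff (mnm_of n (add_delta n [::])))) /eqP.
by rewrite coef_alt // mcoeff0.
Qed.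

Lemma alt_coef_schur n la nu : is_part la -> is_part nu -> (size nu <= n)%N ->
  alt_coef nu (schur la n) = (la == nu)%:R.
Proof.
move=> pla pnu snu; rewrite /alt_coef schurE; case: (leqP (size la) n) => [sla|lt_n].
  by rewrite bialternant ?coef_alt.
rewrite schur_eval_eq0 // mulr0 mcoeff0; case: eqP => // e.
by rewrite e ltnNge snu in lt_n.
Qed.

Lemma schur_eq0 n la : is_part la -> (n < size la)%N -> schur la n = 0.
Proof. by move=> pla lt_n; rewrite schurE schur_eval_eq0. Qed.

Definition deg_le n (p : {mpoly int[n]}) D := forall m, (D < mdeg m)%N -> p@_m = 0.

Lemma msize_deg_le n (p : {mpoly int[n]}) D : (msize p <= D)%N -> deg_le p D.
Proof.
move=> le_D m lt_m; apply/eqP; rewrite mcoeff_eq0; apply: msize_mdeg_ge.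
exact: leq_trans le_D (ltnW lt_m).
Qed.

Lemma deg_le_msize n (p : {mpoly int[n]}) D : deg_le p D -> (msize p <= D.+1)%N.
Proof.
move=> pD; rewrite msizeE; apply/bigmax_leqP_seq => m mp _; rewrite ltnS leqNgt.
apply/negP => /pD/eqP; rewrite mcoeff_eq0; by rewrite mp.
Qed.

Lemma mdeg_mnm_perm n (m : 'X_{1..n}) s : mdeg (mnm_perm m s) = mdeg m.
Proof. exact: mdeg_mperm. Qed.

Lemma mdeg_add_delta n nu : (size nu <= n)%N ->
  mdeg (mnm_of n (add_delta n nu)) = (sumn nu + mdeg (mnm_of n (add_delta n [::])))%N.
Proof.
move=> snu; rewrite (sumn_nth snu) !mdegE -big_split; apply: eq_bigr => i _ /=.
by rewrite !mnmE /add_delta nth_nil.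
Qed.

(** All coefficients of [p] that enter [alt_coef nu p] belong to monomials of degree |nu|. *)
Lemma alt_coef_deg n nu (p : {mpoly int[n]}) D : (size nu <= n)%N -> deg_le p D ->
  (D < sumn nu)%N -> alt_coef nu p = 0.
Proof.
move=> snu pD lt_D; rewrite /alt_coef coef_altM big1 // => s _.
case: ifP => [le_m|_]; rewrite ?mulr0 // pD ?mulr0 //.
have := congr1 (@mdeg n) (submK le_m); rewrite mdegD mdeg_mnm_perm (mdeg_add_delta snu).
by move=> /addIn ->.
Qed.

(** The product with the Vandermonde determinant is alternating and vanishes at all exponents nu +
    delta, hence everywhere; the determinant then cancels. *)
Lemma sym_eq0 n (p : {mpoly int[n]}) : p \is symmetric ->
  (forall nu, is_part nu -> (size nu <= n)%N -> alt_coef nu p = 0) -> p = 0.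
Proof.
move=> sp C0; have /eqP : alt (mvar n) n (add_delta n [::]) * p = 0.
  apply/mpolyP => m; rewrite mcoeff0.
  apply: (alternating_eq0 (@alternating_altM n (add_delta n [::]) p sp)) => m' sm'.
  have [ka [pka ska ->]] := sdecreasing_part sm'; exact: C0.
by rewrite mulf_eq0 (negbTE (alt_delta_neq0 n)) => /eqP.
Qed.

(** * Operations on families and closure properties of Lambda *)

Lemma fam1P (f g : fam1) : (forall n, f n = g n) -> f = g.
Proof. by move=> eq_fg; apply: functional_extensionality_dep. Qed.

Lemma fam_sumE (R : nat -> comNzRingType) I (r : seq I) P (F : I -> Defs.family R) n :
  (\sum_(i <- r | P i) F i) n = \sum_(i <- r | P i) F i n.
Proof. exact: (big_morph (fun f : Defs.family R => f n)). Qed.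

Lemma famMz (R : nat -> comNzRingType) (f : Defs.family R) (a : int) n :
  (f *~ a) n = f n *~ a.
Proof.
have nat_ k : (f *+ k) n = f n *+ k.
  by elim: k => // k IHk; rewrite !mulrS famD IHk.
case: a => k; first exact: nat_.
by rewrite !NegzE !mulrNz -[LHS]/(- ((f *+ k.+1) n)) nat_.
Qed.

(** This and the next lemmas display the component ring as [{mpoly int[n]}], where the polynomial
    lemmas apply. *)
Lemma fam1D (f g : fam1) n : (f + g) n = (f n : {mpoly int[n]}) + g n.
Proof. by []. Qed.

Lemma fam1M (f g : fam1) n : (f * g) n = (f n : {mpoly int[n]}) * g n.
Proof. by []. Qed.

Lemma fam1Mz (f : fam1) a n : (f *~ a) n = (f n : {mpoly int[n]}) *~ a.
Proof. exact: famMz. Qed.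

Lemma fam1_sum I (r : seq I) P (F : I -> fam1) n :
  (\sum_(i <- r | P i) F i) n = \sum_(i <- r | P i) (F i n : {mpoly int[n]}).
Proof. exact: fam_sumE. Qed.

Lemma kill_lastD n (p q : {mpoly int[n.+1]}) :
  kill_last (p + q) = kill_last p + kill_last q.
Proof. exact: rmorphD. Qed.

Lemma kill_lastM n (p q : {mpoly int[n.+1]}) :
  kill_last (p * q) = kill_last p * kill_last q.
Proof. exact: rmorphM. Qed.

Lemma kill_lastMz n (p : {mpoly int[n.+1]}) a :
  kill_last (p *~ a) = kill_last p *~ a.
Proof. exact: raddfMz. Qed.

Lemma in_Lambda0 : in_Lambda 0.
Proof.
split=> [n|n|]; [exact: rpred0|exact: raddf0|].
by exists 0%N => n; rewrite msize0.
Qed.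

Lemma in_Lambda1 : in_Lambda 1.
Proof.
split=> [n|n|]; [exact: rpred1|exact: rmorph1|].
by exists 1%N => n; rewrite msize1.
Qed.

Lemma in_LambdaD f g : in_Lambda f -> in_Lambda g -> in_Lambda (f + g).
Proof.
move=> [sf cf [df bf]] [sg cg [dg bg]]; split=> [n|n|].
- by rewrite fam1D; apply: rpredD; [exact: sf|exact: sg].
- by rewrite !fam1D kill_lastD cf cg.
exists (maxn df dg) => n; apply: leq_trans (msizeD_le _ _) _.
by rewrite geq_max !leq_max bf bg orbT.
Qed.

Lemma in_LambdaMz f a : in_Lambda f -> in_Lambda (f *~ a).
Proof.
move=> [sf cf [df bf]]; split=> [n|n|].
- by rewrite fam1Mz; apply: rpredMz; exact: sf.
- by rewrite !fam1Mz kill_lastMz cf.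
exists df => n; rewrite fam1Mz -scaler_int; apply: leq_trans (mmeasureZ_le _ _ _) _.
exact: bf.
Qed.

Lemma in_LambdaM f g : in_Lambda f -> in_Lambda g -> in_Lambda (f * g).
Proof.
move=> [sf cf [df bf]] [sg cg [dg bg]]; split=> [n|n|].
- by rewrite fam1M; apply: rpredM; [exact: sf|exact: sg].
- by rewrite !fam1M kill_lastM cf cg.
exists (df + dg)%N => n; rewrite fam1M.
have [->|f0] := eqVneq (f n : {mpoly int[n]}) 0; first by rewrite mul0r msize0.
have [->|g0] := eqVneq (g n : {mpoly int[n]}) 0; first by rewrite mulr0 msize0.
by rewrite msizeM // (leq_trans (leq_pred _)) // leq_add.
Qed.

Lemma in_Lambda_sum I (r : seq I) (P : pred I) F :
  (forall i, P i -> in_Lambda (F i)) -> in_Lambda (\sum_(i <- r | P i) F i).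
Proof. by move=> FP; apply: big_ind => //; [exact: in_Lambda0|exact: in_LambdaD]. Qed.

Lemma in_Lambda_prod I (r : seq I) (P : pred I) F :
  (forall i, P i -> in_Lambda (F i)) -> in_Lambda (\prod_(i <- r | P i) F i).
Proof. by move=> FP; apply: big_ind => //; [exact: in_Lambda1|exact: in_LambdaM]. Qed.

Lemma in_LambdaX f k : in_Lambda f -> in_Lambda (f ^+ k).
Proof.
move=> Lf; elim: k => [|k IHk]; first exact: in_Lambda1.
by rewrite exprS; apply: in_LambdaM.
Qed.

Lemma kill_last_mvar n i : (i < n.+1)%N -> kill_last (mvar n.+1 i) = mvar n i.
Proof.
move=> lt_i; rewrite -[i]/(val (Ordinal lt_i)) mvarE /kill_last comp_mpolyXU.
rewrite -tnth_nth tnth_mktuple; case: unliftP => [j ej|ei].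
  have -> : val (Ordinal lt_i) = j by rewrite ej; apply: lift_max.
  by rewrite mvarE.
by rewrite /mvar insubF // ei /= ltnn.
Qed.

Lemma hstrip_refl la : is_part la -> hstrip la la.
Proof. by move=> pla; apply/hstripP => i; rewrite part_nth_le. Qed.

Lemma hstrip_sumn la ka : is_part la -> is_part ka -> hstrip la ka ->
  (sumn ka <= sumn la)%N /\ (sumn ka = sumn la -> ka = la).
Proof.
move=> pla pka /hstripP strip; pose n := maxn (size la) (size ka).
rewrite (@sumn_nth la n) ?leq_maxl // (@sumn_nth ka n) ?leq_maxr //.
split; first by apply: leq_sum => i _; case: (strip i).
move=> eq_sum; apply: part_eq => // i; case: (ltnP i n) => [lt_i|]; last first.
  by rewrite geq_max => /andP[? ?]; rewrite !nth_default.
apply/eqP; rewrite eqn_leq (strip i).2 /= leqNgt; apply/negP => lt_nth.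
have : (\sum_(j < n) nth 0 ka j < \sum_(j < n) nth 0 la j)%N.
  rewrite (bigD1 (Ordinal lt_i)) //= [X in (_ < X)%N](bigD1 (Ordinal lt_i)) //=.
  rewrite -addSn leq_add //; apply: leq_sum => j _; exact: (strip j).2.
by rewrite eq_sum ltnn.
Qed.

(** At last variable 0, a branching term survives only if its strip is empty, that is, if [ka] is
    [la]. *)
Lemma schur_kill la n : is_part la -> kill_last (schur la n.+1) = schur la n.
Proof.
move=> pla; rewrite !schurE /kill_last.
rewrite (rmorph_schur_eval (comp_mpoly _)) (eq_schur_eval (y := mvar n)); last first.
  by move=> i lt_i; apply: kill_last_mvar.
have sq : la \in square_parts (sumn la) by apply: square_parts_sumn.
rewrite (schur_eval_branch _ _ sq) big_mkcond /= (bigD1_seq la) ?square_parts_uniq //=.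
rewrite hstrip_refl // subnn expr0 mul1r big_seq_cond big1 ?addr0 //.
move=> ka /andP[/square_parts_part pka ne]; case: ifP => // strip.
have [le_sum eq_sum] := hstrip_sumn pla pka strip.
rewrite (_ : mvar n n = 0); last by rewrite /mvar insubF ?ltnn.
rewrite expr0n subn_eq0 leqNgt ltn_neqAle le_sum andbT.
by case: eqP => [/eq_sum e|_]; [rewrite e eqxx in ne|rewrite mul0r].
Qed.

(** The symmetry is not visible on tableaux. It follows from [bialternant]: a_delta and a_delta s_la
    change by the same sign, and a_delta cancels. *)
Lemma schur_in_Lambda la : is_part la -> in_Lambda (schur la).
Proof.
move=> pla; split=> [n|n|]; last 2 first.
- exact: schur_kill.
- exists (#|cell la|.+1) => n; apply: leq_trans (msize_sum _ _ _) _.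
  apply/bigmax_leqP_seq => T _ _; rewrite mprodXE msizeX ltnS.
  by rewrite mdeg_sum (eq_bigr (fun=> 1%N)) ?sum1_card // => c _; rewrite mdeg1.
case: (leqP (size la) n) => [sla|lt_n]; last by rewrite schur_eq0 // rpred0.
apply/issymP => s; apply: (mulfI (alt_delta_neq0 n)).
have := msym_alt (add_delta n la) s; rewrite -(bialternant (mvar n) pla sla) -schurE.
rewrite msymM msym_alt -!mulrA => /(mulfI _); apply.
by rewrite signr_eq0.
Qed.

Lemma kill_last_coef n (p : {mpoly int[n.+1]}) m :
  (kill_last p)@_m = p@_(mnmwiden m).
Proof.
rewrite /kill_last comp_mpolyEX [in RHS](mpolyE p) !raddf_sum /=.
apply: eq_bigr => M _; rewrite !mcoeffZ; congr (_ * _).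
rewrite comp_mpolyX mcoeffX big_ord_recr /= tnth_mktuple unlift_none.
rewrite (eq_bigr (fun i : 'I_n => 'X_i ^+ M (widen_ord (leqnSn n) i))); last first.
  move=> i _; rewrite tnth_mktuple -(_ : lift ord_max i = widen_ord (leqnSn n) i).
    by rewrite liftK.
  by apply: ord_inj; rewrite lift_max.
pose M' : 'X_{1..n} := [multinom M (widen_ord (leqnSn n) i) | i < n].
have -> : \prod_(i < n) 'X_i ^+ M (widen_ord (leqnSn n) i) = 'X_[M'] :> {mpoly int[n]}.
  by rewrite mpolyXE_id; apply: eq_bigr => i _; rewrite mnmE.
rewrite expr0n; case: eqP => [M0|Mn0] /=.
  rewrite mulr1 mcoeffX; congr (_%:R); congr (nat_of_bool _).
  apply/eqP/eqP => [<-|e]; apply/mnmP => i; last by rewrite mnmE e mnmwiden_widen.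
  case: (unliftP ord_max i) => [j ->|->]; last by rewrite M0 mnmwiden_ordmax.
  have -> : lift ord_max j = widen_ord (leqnSn n) j.
    by apply: ord_inj; rewrite lift_max.
  by rewrite mnmwiden_widen mnmE.
rewrite mulr0 mcoeff0; case: eqP => // e; case: Mn0.
by rewrite e mnmwiden_ordmax.
Qed.

(** At last variable 0, the Vandermonde determinant in n+1 variables becomes x_0 ... x_(n-1) times
    the one in n variables. This shift of all exponents by one matches the passage from delta in n
    to delta in n+1 variables. *)
Lemma alt_coef_stable nu (f : fam1) n : in_Lambda f -> (size nu <= n)%N ->
  alt_coef nu (f n.+1) = alt_coef nu (f n).
Proof.
move=> [_ cf _] snu; pose M := [multinom (add_delta n nu i).+1 | i < n].
have -> : alt_coef nu (f n.+1)
    = (kill_last (alt (mvar n.+1) n.+1 (add_delta n.+1 [::]) * (f n.+1 :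
      {mpoly int[n.+1]})))@_M.
  rewrite kill_last_coef /alt_coef; congr (_@__); apply/mnmP => i; rewrite mnmE.
  case: (unliftP ord_max i) => [j ->|->]; last first.
    by rewrite mnmwiden_ordmax /add_delta subnn addn0 nth_default.
  have -> : lift ord_max j = widen_ord (leqnSn n) j.
    by apply: ord_inj; rewrite lift_max.
  by rewrite mnmwiden_widen mnmE /add_delta /= subSS -addnS subnSK.
rewrite kill_lastM cf /kill_last (rmorph_alt (comp_mpoly _)).
rewrite (@eq_alt _ _ (mvar n) _ _ (add_delta n.+1 [::])) //; last first.
  by move=> i lt_i; apply: kill_last_mvar.
rewrite (@alt_branch _ 0) //; last by rewrite mem_square_parts.
rewrite square_parts0 big_cons big_nil /= addr0 expr0 mul1r.
have -> : \prod_(i < n) (mvar n i - mvar n n) = 'X_[[multinom 1%N | i < n]].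
  rewrite mpolyXE_id; apply: eq_bigr => i _; rewrite mnmE mvarE expr1.
  by rewrite /mvar insubF ?ltnn ?subr0.
rewrite -mulrA mcoeff_Xmul; case: ifPn => [_|/negP[]].
  by congr (_@__); apply/mnmP => i; rewrite mnmBE !mnmE subn1.
by apply/mnm_lepP => i; rewrite !mnmE.
Qed.

(** * Schur coefficients and finite Schur expansions in Lambda *)

Definition schur_coef nu (f : fam1) : int := alt_coef nu (f (size nu)).

(** [schur_coef] works in the fewest variables allowed; stability permits any larger number, so
    several partitions can be treated in common variables. *)
Lemma schur_coefE n nu f : in_Lambda f -> (size nu <= n)%N ->
  schur_coef nu f = alt_coef nu (f n).
Proof.
move=> Lf snu; rewrite -(subnK snu) addnC; elim: (n - size nu)%N => [|k IHk].
  by rewrite addn0.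
by rewrite addnS alt_coef_stable ?leq_addr.
Qed.

Lemma schur_coefMz nu f a : schur_coef nu (f *~ a) = schur_coef nu f * a.
Proof. by rewrite /schur_coef fam1Mz raddfMz -mulrzr intz. Qed.

Lemma schur_coef_sum nu I (r : seq I) (P : pred I) F :
  schur_coef nu (\sum_(i <- r | P i) F i) = \sum_(i <- r | P i) schur_coef nu (F i).
Proof. by rewrite /schur_coef fam1_sum raddf_sum. Qed.

Lemma schur_coef_schur la nu : is_part la -> is_part nu ->
  schur_coef nu (schur la) = (la == nu)%:R.
Proof. by move=> pla pnu; rewrite /schur_coef alt_coef_schur. Qed.

Lemma schur_coef_inj f g : in_Lambda f -> in_Lambda g ->
  (forall nu, is_part nu -> schur_coef nu f = schur_coef nu g) -> f = g.
Proof.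
move=> Lf Lg eq_c; apply: fam1P => n; apply/eqP; rewrite -subr_eq0; apply/eqP.
apply: sym_eq0 => [|nu pnu snu].
  by apply: rpredB; [exact: Lambda_sym|exact: Lambda_sym].
have -> : alt_coef nu ((f n : {mpoly int[n]}) - g n) =
  alt_coef nu (f n) - alt_coef nu (g n).
  exact: raddfB.
by rewrite -!schur_coefE // eq_c ?subrr.
Qed.

Definition schur_sum D f :
  fam1 := \sum_(nu <- square_parts D) schur nu *~ schur_coef nu f.

Lemma in_Lambda_schur_sum (s : seq (seq nat)) a : {subset s <= is_part} ->
  in_Lambda (\sum_(nu <- s) schur nu *~ a nu).
Proof.
move=> ps; rewrite big_seq; apply: in_Lambda_sum => nu /ps pnu.
exact/in_LambdaMz/schur_in_Lambda.
Qed.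

Lemma schur_coef_schur_sum (s : seq (seq nat)) a mu : uniq s -> {subset s <= is_part} ->
  is_part mu -> schur_coef mu (\sum_(nu <- s) schur nu *~ a nu) =
    if mu \in s then a mu else 0.
Proof.
move=> us ps pmu; rewrite schur_coef_sum; case: ifPn => [mu_s|mu_s].
  rewrite (bigD1_seq mu) //= schur_coefMz schur_coef_schur // eqxx mul1r
    big_seq_cond big1 ?addr0 //.
  by move=> nu /andP[/ps pnu ne];
    rewrite schur_coefMz schur_coef_schur // (negbTE ne) mul0r.
rewrite big_seq big1 // => nu nu_s; rewrite schur_coefMz schur_coef_schur ?ps //.
  by case: eqP => [e|_]; [rewrite -e nu_s in mu_s|rewrite mul0r].
exact: ps.
Qed.

Lemma square_parts_is_part D : {subset square_parts D <= is_part}.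
Proof. by move=> nu /square_parts_part. Qed.

Lemma schur_coef_deg f : in_Lambda f -> exists d, forall nu,
  is_part nu -> (d < sumn nu)%N -> schur_coef nu f = 0.
Proof.
case=> _ _ [d fd]; exists d => nu pnu lt_d.
by rewrite /schur_coef (alt_coef_deg (D := d)) //; apply: msize_deg_le.
Qed.

(** The bounded degree leaves finitely many coefficients. Allowing every large [D] lets several
    elements be expanded over one square. *)
Lemma schur_expand f : in_Lambda f -> exists d, forall D, (d <= D)%N ->
  f = schur_sum D f.
Proof.
move=> Lf; have [d fd] := schur_coef_deg Lf; exists d => D le_D.
have ps := @square_parts_is_part D.
apply: schur_coef_inj => // [|nu pnu]; first exact: in_Lambda_schur_sum.
rewrite schur_coef_schur_sum ?square_parts_uniq //; case: ifPn => // nsq.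
rewrite fd // ltnNge; apply: contra nsq => le_d.
exact: square_parts_sumn (leq_trans le_d le_D).
Qed.

(** * Pieri's rules *)

(* The complete ([v = false]) and elementary ([v = true]) symmetric functions. *)
Definition squarefree_if (v : bool) n (m : 'X_{1..n}) := v ==> [forall i, m i <= 1]%N.

Definition pieri_sym (v : bool) r : fam1 := fun n =>
  \sum_(m : 'X_{1..n < r.+1} | (mdeg m == r) && squarefree_if v m) 'X_[m].

Lemma pieri_sym_coef v r n m :
  (pieri_sym v r n)@_m = ((mdeg m == r) && squarefree_if v m)%:R.
Proof.
rewrite /pieri_sym raddf_sum /=; case: (boolP (_ && _)) => [Pm|Pm]; last first.
  rewrite big1 // => k Pk; rewrite mcoeffX; case: eqP => // e.
  by rewrite e (negbTE Pm) in Pk.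
have lt_m : (mdeg m < r.+1)%N by case/andP: Pm => /eqP ->.
rewrite (bigD1 (BMultinom lt_m)) //= mcoeffX eqxx big1 ?addr0 //.
move=> k /andP[_ ne]; rewrite mcoeffX; case: eqP => // e.
by case/eqP: ne; apply: val_inj.
Qed.

Lemma squarefree_mnm_perm v n (m : 'X_{1..n}) s :
  squarefree_if v (mnm_perm m s) = squarefree_if v m.
Proof.
congr (_ ==> _); apply/forallP/forallP => H i; last by rewrite mnm_permE.
by have := H (s^-1 i)%g; rewrite mnm_permE permKV.
Qed.

Lemma mdeg_mnmwiden n (m : 'X_{1..n}) : mdeg (mnmwiden m) = mdeg m.
Proof.
rewrite !mdegE big_ord_recr /= mnmwiden_ordmax addn0.
by apply: eq_bigr => i _; rewrite mnmwiden_widen.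
Qed.

Lemma squarefree_mnmwiden v n (m : 'X_{1..n}) :
  squarefree_if v (mnmwiden m) = squarefree_if v m.
Proof.
congr (_ ==> _); apply/forallP/forallP => H i.
  by have := H (widen_ord (leqnSn n) i); rewrite mnmwiden_widen.
case: (unliftP ord_max i) => [j ->|->]; last by rewrite mnmwiden_ordmax.
have -> : lift ord_max j = widen_ord (leqnSn n) j.
  by apply: ord_inj; rewrite lift_max.
by rewrite mnmwiden_widen.
Qed.

Lemma pieri_sym_in_Lambda v r : in_Lambda (pieri_sym v r).
Proof.
split=> [n|n|].
- apply/issymP => s; apply/mpolyP => m; rewrite mcoeff_sym.
  rewrite -[X in _@_X]/(mnm_perm m s) !pieri_sym_coef mdeg_mnm_perm
    squarefree_mnm_perm //.
- apply/mpolyP => m; rewrite kill_last_coef !pieri_sym_coef.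
  by rewrite mdeg_mnmwiden squarefree_mnmwiden.
exists r.+1 => n; apply: deg_le_msize => m lt_m; rewrite pieri_sym_coef.
by rewrite gtn_eqF.
Qed.

Lemma pieri_sym_mul_coef v r n (p : {mpoly int[n]}) M : (p * pieri_sym v r n)@_M =
  \sum_(g : 'X_{1..n < (mdeg M).+1} |
     [&& (g <= M)%MM, (mdeg g + r == mdeg M)%N & squarefree_if v (M - g)%MM]) p@_g.
Proof.
rewrite mcoeffM.
under eq_bigr do rewrite pieri_sym_coef mulr_natr mulrb.
rewrite -big_mkcondr /=.
apply: (reindex_seq (f := fun k : 'X_{1..n < (mdeg M).+1, (mdeg M).+1} => k.1));
  rewrite ?index_enum_uniq //.
- move=> [a b] _ /= /andP[/eqP eM /andP[/eqP db sb]].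
  have le_a := lem_addr a b; rewrite -eM in le_a.
  have eb : (M - a = b)%MM by rewrite -[RHS](addmK a b) (addmC b a) -eM.
  by rewrite mem_index_enum le_a eb sb -db -mdegD -eM eqxx.
- move=> [a b] [a' b'] _ _ /= /andP[/eqP eM _] /andP[/eqP eM' _] e.
  congr pair => //; apply: val_inj.
  by have := etrans (esym eM) eM'; rewrite e => /addmI.
move=> g _ /and3P[le_g dg sg].
have lt_b : (mdeg (M - g)%MM < (mdeg M).+1)%N by rewrite ltnS mdegB.
exists (g, BMultinom lt_b) => //; rewrite mem_index_enum /= addmC submK // eqxx sg.
by rewrite andbT -(eqn_add2l (mdeg g)) -mdegD addmC submK // eq_sym.
Qed.

Section Pieri.
Variables (n : nat) (nu : seq nat).
Hypotheses (pnu : is_part nu) (snu : (size nu <= n)%N).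
Let M := mnm_of n (add_delta n nu).
Variable F : 'X_{1..n} -> int.
Hypothesis altF : alternating F.

Let sM : sdecreasing M. Proof. exact: add_delta_sdecreasing. Qed.

Let sM_le (i j : 'I_n) : (i <= j)%N -> (M j <= M i)%N.
Proof. by rewrite leq_eqVlt => /orP[/eqP/ord_inj ->|/sM/ltnW]. Qed.

Lemma add_delta_le ka : is_part ka -> (size ka <= n)%N ->
  (mnm_of n (add_delta n ka) <= M)%MM =
    all (fun i => nth 0 ka i <= nth 0 nu i)%N (iota 0 n).
Proof.
move=> pka ska; apply/mnm_lepP/allP => H i.
  rewrite mem_iota => /= lt_i; have := H (Ordinal lt_i).
  by rewrite !mnmE /add_delta leq_add2r.
by rewrite !mnmE /add_delta leq_add2r; apply: H; rewrite mem_iota ltn_ord.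
Qed.

(** The common end of both Pieri rules: [P] describes the exponents that survive the cancellation.
    They are strictly decreasing, hence of the form ka + delta, and compare with nu + delta as the
    rows of [ka] with those of [nu]. *)
Lemma strip_sum D r v (P : pred 'X_{1..n}) :
  nu \in square_parts D ->
  (forall g, (g <= M)%MM -> P g -> sdecreasing g) ->
  (forall ka, is_part ka -> (size ka <= n)%N ->
     (mnm_of n (add_delta n ka) <= M)%MM && P (mnm_of n (add_delta n ka)) =
     if v then vstrip nu ka else hstrip nu ka) ->
  \sum_(g : 'X_{1..n < (mdeg M).+1} |
     [&& (g <= M)%MM, (mdeg g + r == mdeg M)%N & P g]) F g =
  \sum_(ka <- square_parts D | (if v then vstrip nu ka else hstrip nu ka)
      && (sumn ka + r == sumn nu)%N) F (mnm_of n (add_delta n ka)).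
Proof.
move=> sq Psdec Pstrip; have [_ sD nD] := square_partsP _ _ sq.
have strip_le ka i : (if v then vstrip nu ka else hstrip nu ka) ->
    (nth 0 ka i <= nth 0 nu i)%N.
  by case: (v) => [/vstripP|/hstripP] H; case: (H i).
have strip_size ka : is_part ka -> (if v then vstrip nu ka else hstrip nu ka) ->
    (size ka <= n)%N.
  move=> pka st; rewrite part_size_le // -leqn0.
  by apply: leq_trans (strip_le _ n st) _; rewrite nth_default.
have deg ka : (size ka <= n)%N ->
    (mdeg (mnm_of n (add_delta n ka)) + r == mdeg M)%N = (sumn ka + r == sumn nu)%N.
  by move=> ska; rewrite (mdeg_add_delta ska) (mdeg_add_delta snu) addnAC eqn_add2r.
have lt_deg g : (g <= M)%MM -> (mdeg g < (mdeg M).+1)%N.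
  by move=> le_g; rewrite ltnS -(submK le_g) mdegD leq_addl.
have lt0 : (mdeg (0%MM : 'X_{1..n}) < (mdeg M).+1)%N by rewrite mdeg0.
(* The default monomial 1 is never taken on strips, by [fE]. *)
pose f (ka : seq nat) : 'X_{1..n < (mdeg M).+1} :=
  insubd (BMultinom lt0) (mnm_of n (add_delta n ka)).
have fE ka : is_part ka -> (if v then vstrip nu ka else hstrip nu ka) ->
    f ka = mnm_of n (add_delta n ka) :> 'X_{1..n}.
  move=> pka st; have ska := strip_size _ pka st.
  rewrite /f [LHS]val_insubd lt_deg //.
  by move: st; rewrite -Pstrip // => /andP[].
apply/esym; apply: (reindex_seq (f := f));
  rewrite ?square_parts_uniq ?index_enum_uniq //.
- move=> ka /square_parts_part pka /andP[st dk]; rewrite mem_index_enum (fE ka) //.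
  have ska := strip_size _ pka st; split=> //; rewrite (deg _ ska) dk.
  by move: st; rewrite -Pstrip // => /andP[-> ->].
- move=> ka ka' /square_parts_part pka /square_parts_part pka'.
  case/andP=> st _ /andP[st' _] /(congr1 (@bmnm _ _)); rewrite !fE //.
  by move/add_delta_inj; apply=> //; apply: strip_size.
move=> g _ /and3P[le_g dg Pg].
have [ka [pka ska eg]] := sdecreasing_part (Psdec g le_g Pg).
have st : if v then vstrip nu ka else hstrip nu ka by rewrite -Pstrip // -eg le_g.
exists ka; last by apply: val_inj; rewrite [LHS]fE // -eg.
rewrite st -deg // -eg dg !andbT; apply/square_partsP; split=> //.
  rewrite part_size_le // -leqn0; apply: leq_trans (strip_le _ D st) _.
  by rewrite nth_default.
by move=> i; apply: leq_trans (strip_le _ i st) (nD i).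
Qed.

(** M is strictly decreasing and g lowers its entries by at most 1, so g is weakly decreasing. If g
    is not strictly decreasing, two of its exponents agree and F vanishes. *)
Lemma pieri_e D r : nu \in square_parts D ->
  \sum_(g : 'X_{1..n < (mdeg M).+1} |
     [&& (g <= M)%MM, (mdeg g + r == mdeg M)%N & squarefree_if true (M - g)%MM]) F g =
  \sum_(ka <- square_parts D | vstrip nu ka && (sumn ka + r == sumn nu)%N)
     F (mnm_of n (add_delta n ka)).
Proof.
move=> sq; pose sdecb (g : 'X_{1..n}) := [forall i : 'I_n, forall j :
  'I_n, (i < j)%N ==> (g j < g i)%N].
have sdecbP g : reflect (sdecreasing g) (sdecb g).
  apply: (iffP forallP) => [H i j lt_ij|H i]; last by apply/forallP => j;
    apply/implyP/H.
  by have /forallP/(_ j)/implyP := H i; apply.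
rewrite -(@strip_sum D r true [pred g | squarefree_if true (M - g)%MM & sdecb g]) //.
- rewrite (bigID (fun g : 'X_{1..n < _} => sdecb g)) /= [X in _ + X]big1 ?addr0.
    by apply: eq_bigl => g; rewrite -!andbA.
  move=> g /andP[/and3P[/mnm_lepP le_g _ /forallP sq_g] nsd].
  have [i [j [lt_ij le_ij]]] : exists i j : 'I_n, (i < j)%N /\ (g i <= g j)%N.
    case/forallPn: nsd => i /forallPn[j]; rewrite negb_imply -leqNgt => /andP[? ?].
    by exists i, j.
  apply: (@alternating_noninj _ _ i j) => //; first by rewrite neq_ltn lt_ij.
  have := sM lt_ij; have := le_g i; have := le_g j; have := sq_g i; have := sq_g j.
  by rewrite !mnmBE; move: (g i) (g j) (M i) (M j) le_ij => a b c d; lia.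
- by move=> g _ /andP[_ /sdecbP].
move=> ka pka ska; rewrite add_delta_le // inE /=.
have -> : sdecb (mnm_of n (add_delta n ka)) by apply/sdecbP/add_delta_sdecreasing.
rewrite andbT; apply/andP/vstripP => [[/allP le_ka /forallP sf] i|H].
  case: (ltnP i n) => [lt_i|le_i].
    split; first by apply: le_ka; rewrite mem_iota.
    have := sf (Ordinal lt_i); rewrite mnmBE !mnmE /add_delta subnDr.
    by rewrite leq_subLR addn1.
  by rewrite !nth_default // (leq_trans _ le_i).
split; first by apply/allP => i _; case: (H i).
by apply/forallP => i; rewrite mnmBE !mnmE /add_delta subnDr leq_subLR addn1;
  case: (H i).
Qed.

(* Exchanging two neighbouring exponents cancels the terms which are not
   horizontal strips. *)
Lemma pieri_h D r : nu \in square_parts D ->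
  \sum_(g : 'X_{1..n < (mdeg M).+1} |
     [&& (g <= M)%MM, (mdeg g + r == mdeg M)%N & squarefree_if false (M - g)%MM]) F g =
  \sum_(ka <- square_parts D | hstrip nu ka && (sumn ka + r == sumn nu)%N)
     F (mnm_of n (add_delta n ka)).
Proof.
move=> sq.
(* For g = ka + delta, the condition at (i, i+1) says ka_i < nu_(i+1): interlacing fails there. *)
pose B (g : 'X_{1..n}) (p :
  'I_n * 'I_n) := (p.2 == p.1.+1 :> nat) && (g p.1 <= M p.2)%N.
pose bad g := [exists p, B g p].
rewrite -(@strip_sum D r false [pred g | ~~ bad g]) //; last 2 first.
- move=> g /mnm_lepP le_g /existsPn nb i j lt_ij.
  have lt_i1 : (i.+1 < n)%N by apply: leq_ltn_trans lt_ij _.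
  have := nb (i, Ordinal lt_i1); rewrite /B eqxx /= -ltnNge; apply: leq_ltn_trans.
  by apply: leq_trans (le_g j) _; apply: sM_le.
- move=> ka pka ska; rewrite add_delta_le // inE /=.
  apply/andP/hstripP => [[/allP le_ka /existsPn nb] i|H].
    case: (ltnP i n) => [lt_i|le_i]; last first.
      rewrite (nth_default 0%N (leqW (leq_trans snu le_i))).
      by rewrite (nth_default 0%N (leq_trans snu le_i)) (nth_default 0%N (leq_trans
        ska le_i)).
    split; last by apply: le_ka; rewrite mem_iota.
    case: (ltnP i.+1 n) => [lt_i1|le_i]; last first.
      by rewrite nth_default // (leq_trans _ le_i).
    have := nb (Ordinal lt_i, Ordinal lt_i1).
    by rewrite /B eqxx /= -ltnNge !mnmE /add_delta /=; lia.
  split; first by apply/allP => i _; case: (H i).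
  apply/existsPn => -[i j]; rewrite /B /=; apply/negP => /andP[/eqP ej].
  by rewrite !mnmE /add_delta ej; have := H i; have := ltn_ord j; lia.
rewrite (bigID (fun g : 'X_{1..n < _} => bad g)) /=.
rewrite [X in _ + X](eq_bigl (fun g : 'X_{1..n < (mdeg M).+1} =>
  [&& (g <= M)%MM, (mdeg g + r == mdeg M)%N & ~~ bad g])); last first.
  by move=> g; rewrite andbT -!andbA.
rewrite [X in X + _](_ : _ = 0) ?add0r //.
(* At the first failure (i, i+1) both exponents are at most M_(i+1), so after their exchange the
   failure persists. Earlier conditions involve only earlier exponents, so it remains the first and
   the exchange is an involution. *)
pose first g p := B g p && [forall q, B g q ==> (p.1 <= q.1)%N].
have first_inj g p q : first g p -> first g q -> p = q.
  case: p q => [i j] [i' j'] /andP[/= /andP[/eqP ej Bp] /forallP Hp].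
  case/andP=> /= /andP[/eqP ej' Bq] /forallP Hq.
  have le_i : (i <= i')%N by have /implyP := Hp (i', j'); apply; rewrite /B /= ej' eqxx.
  have le_i' : (i' <= i)%N by have /implyP := Hq (i, j); apply; rewrite /B /= ej eqxx.
  have eqi : i = i' by apply: ord_inj; apply/eqP; rewrite eqn_leq le_i.
  by congr pair => //; apply: ord_inj; rewrite ej ej' eqi.
have first_ex g : bad g -> exists p, first g p.
  move=> /existsP[p0 Bp0].
  have [p Bp minp] := @arg_minnP _ p0 (B g) (fun p => val p.1) Bp0.
  exists p; rewrite /first Bp /=; apply/forallP => q; apply/implyP; exact: minp.
pose sw g := if [pick p | first g p] is Some p then tperm p.1 p.2 else 1%g.
have swE g p : first g p -> sw g = tperm p.1 p.2.
  move=> Fp; rewrite /sw; case: pickP => [q Fq|/(_ p)]; last by rewrite Fp.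
  by rewrite (first_inj _ _ _ Fp Fq).
have sw1 g : ~~ bad g -> sw g = 1%g.
  move=> nb; rewrite /sw; case: pickP => // p /andP[Bp _].
  by case/negP: nb; apply/existsP; exists p.
have sw_le g p : (g <= M)%MM -> first g p -> (mnm_perm g (sw g) <= M)%MM.
  move=> /mnm_lepP le_g Fp; rewrite (swE _ _ Fp); case: p Fp => [i j].
  case/andP=> /= /andP[/eqP /= ej Bg] _; apply/mnm_lepP => k; rewrite mnm_permE.
  have le_ij : (i <= j)%N by rewrite ej.
  by case: tpermP => [->|->|_ _] //; apply: leq_trans (le_g j) (sM_le le_ij).
have first_sw g p : (g <= M)%MM -> first g p -> first (mnm_perm g (sw g)) p.
  move=> /mnm_lepP le_g Fp; rewrite (swE _ _ Fp); case: p Fp => [i j].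
  case/andP=> /= /andP[/eqP /= ej Bg] /forallP Fg.
  apply/andP; split; first by rewrite /B /= ej eqxx mnm_permE tpermL /=.
  apply/forallP => q; apply/implyP => /andP[eq Bq] /=; rewrite leqNgt.
  apply/negP => lt_q; have := Fg q; rewrite leqNgt lt_q implybF.
  case/negP; rewrite /B eq /=; move: Bq; rewrite mnm_permE tpermD //.
    by apply/eqP => e; rewrite e ltnn in lt_q.
  by apply/eqP => e; move: lt_q; rewrite -e ej; lia.
have swK g : (g <= M)%MM -> bad g ->
  mnm_perm (mnm_perm g (sw g)) (sw (mnm_perm g (sw g))) = g.
  move=> le_g /first_ex[p Fp]; have Fp' := first_sw _ _ le_g Fp.
  rewrite {1}(swE _ _ Fp') (swE _ _ Fp).
  by apply/mnmP => k; rewrite !mnm_permE tpermK.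
pose Q (g : 'X_{1..n < (mdeg M).+1}) :=
  [&& (g <= M)%MM, (mdeg g + r == mdeg M)%N & bad g].
have lt_sw (g : 'X_{1..n < (mdeg M).+1}) : (mdeg (mnm_perm g (sw g)) < (mdeg M).+1)%N.
  by rewrite mdeg_mnm_perm bmdeg.
pose h g := BMultinom (lt_sw g).
have hQ g : Q g -> Q (h g).
  case/and3P=> le_g dg bg; have [p Fp] := first_ex _ bg; apply/and3P; split.
  - exact: sw_le Fp.
  - by rewrite /= mdeg_mnm_perm.
  by have /andP[Bp _] := first_sw _ _ le_g Fp; apply/existsP; exists p.
have hK g : Q g -> h (h g) = g.
  by case/and3P=> le_g _ bg; apply: val_inj; apply: swK.
have Fh g : Q g -> F (h g) = - F g.
  case/and3P=> _ _ /first_ex[p Fp]; rewrite /= altF (swE _ _ Fp) odd_tperm.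
  have -> : p.1 != p.2.
    case/andP: Fp => /andP[/eqP e _] _; apply/eqP => e'.
    by move: e; rewrite e'; lia.
  by rewrite expr1 mulN1r.
(* The involution changes the sign of each term. A fixed point has F g = - F g, so in all cases the
   sum is its own negative. *)
have SN : \sum_(g | Q g) F g = \sum_(g | Q g) - F g.
  apply: (reindex_seq (f := h)); rewrite ?index_enum_uniq //.
  - by move=> g _ Qg; rewrite mem_index_enum hQ // Fh // opprK.
  - by move=> g g' _ _ Qg Qg' e; rewrite -(hK _ Qg) e hK.
  by move=> g _ Qg; exists (h g); rewrite ?hK // mem_index_enum hQ.
rewrite (eq_bigl Q); last by move=> g; rewrite /Q andbT -!andbA.
by move: SN; rewrite sumrN; move: (\sum_(g | Q g) F g) => S; lia.
Qed.
End Pieri.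

(** * Kostka numbers *)

Definition strip_if (v : bool) la ka := if v then vstrip la ka else hstrip la ka.

(** With F m the coefficient of x^m in a_delta f, the values of F left by the cancellation are Schur
    coefficients of [f]. *)
Lemma schur_coef_pieri_sym_mul v r f nu D : in_Lambda f -> nu \in square_parts D ->
  schur_coef nu (f * pieri_sym v r) =
  \sum_(ka <- square_parts D | strip_if v nu ka && (sumn ka + r == sumn nu)%N)
     schur_coef ka f.
Proof.
move=> Lf sq; have pnu := square_parts_part sq.
set n := size nu; have Lhe := pieri_sym_in_Lambda v r.
rewrite /schur_coef -/n fam1M /alt_coef mulrA pieri_sym_mul_coef.
have altF := @alternating_altM n (add_delta n [::]) _ (Lambda_sym Lf n).
transitivity (\sum_(ka <- square_parts D | strip_if v nu ka && (sumn ka + r == sumn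
  nu)%N)
  (alt (mvar n) n (add_delta n [::]) * (f n :
    {mpoly int[n]}))@_(mnm_of n (add_delta n ka))).
  by case: v {Lhe}; [apply: (pieri_e _ _ altF)|apply: (pieri_h _ _ altF)].
rewrite big_seq_cond [RHS]big_seq_cond; apply: eq_bigr => ka /andP[sqka /andP[st _]].
have pka := square_parts_part sqka.
rewrite -[LHS]/(alt_coef ka (f n)) -[RHS]/(schur_coef ka f) (schur_coefE (n := n)) //.
rewrite part_size_le // -leqn0.
have le_ka : (nth 0 ka n <= nth 0 nu n)%N.
  by case: (v) st => [/vstripP|/hstripP] H; case: (H n).
by apply: leq_trans le_ka _; rewrite nth_default.
Qed.

(** The images of [f] and [g] split the variables, so a monomial factors uniquely. This serves both
    for separating the last variable and for the two sets of variables in [tens]. *)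
Lemma mcoeff_join n k N (f : 'I_n -> 'I_N) (g : 'I_k -> 'I_N)
    (p : {mpoly int[n]}) (q : {mpoly int[k]}) M :
  injective f -> injective g -> (forall i j, f i != g j) ->
  (forall l, (exists i, l = f i) \/ (exists j, l = g j)) ->
  ((p \mPo [tuple 'X_(f i) | i < n]) * (q \mPo [tuple 'X_(g j) | j < k]))@_M
  = p@_[multinom M (f i) | i < n] * q@_[multinom M (g j) | j < k].
Proof.
move=> inj_f inj_g ne_fg cov.
have compX l (h : 'I_l -> 'I_N) (a : 'X_{1..l}) :
    'X_[a] \mPo [tuple 'X_(h i) | i < l]
    = 'X_[(\sum_(i < l) (U_(h i) *+ a i))%MM] :> {mpoly int[N]}.
  rewrite comp_mpolyX -mprodXnE; apply: eq_bigr => i _.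
  by rewrite tnth_mktuple.
have pushE l (h : 'I_l -> 'I_N) (a : 'X_{1..l}) i : injective h ->
    (\sum_(i < l) (U_(h i) *+ a i))%MM (h i) = a i.
  move=> inj_h; rewrite mnm_sumE (bigD1 i) //= mulmnE mnm1E eqxx mul1n big1 ?addn0 //.
  by move=> j ne; rewrite mulmnE mnm1E (inj_eq inj_h) (negbTE ne).
have push0 l (h : 'I_l -> 'I_N) (a : 'X_{1..l}) x : (forall i, h i != x) ->
    (\sum_(i < l) (U_(h i) *+ a i))%MM x = 0%N.
  by move=> ne; rewrite mnm_sumE big1 // => j _; rewrite mulmnE mnm1E (negbTE (ne j)).
have coefE l (r : {mpoly int[l]}) m : r@_m = \sum_(a <- msupp r) r@_a * (a == m)%:R.
  rewrite {1}(mpolyE r) raddf_sum /=; apply: eq_bigr => a _.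
  by rewrite mcoeffZ mcoeffX.
rewrite (coefE _ p) (coefE _ q) (comp_mpolyEX p) (comp_mpolyEX q) !big_distrlr
  raddf_sum /=.
apply: eq_bigr => a _; rewrite raddf_sum /=; apply: eq_bigr => b _.
rewrite -scalerAl -scalerAr !mcoeffZ !compX -mpolyXD mcoeffX mulrACA -mulrA.
congr (_ * (_ * _)); rewrite -natrM mulnb; congr (nat_of_bool _)%:R.
apply/eqP/andP => [<-|[/eqP -> /eqP ->]].
  split; apply/eqP/mnmP => i; rewrite mnmE mnmDE pushE // push0 ?addn0 //.
  by move=> j; rewrite eq_sym.
apply/mnmP => l; rewrite mnmDE; case: (cov l) => -[i ->].
  by rewrite pushE // push0 ?addn0 ?mnmE // => j; rewrite eq_sym.
by rewrite push0 // pushE // mnmE.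
Qed.

(** The exponent of the last variable prescribes the size of the strip. *)
Lemma schur_branch_coef D n nu (M : 'X_{1..n.+1}) : nu \in square_parts D ->
  (schur nu n.+1)@_M =
  \sum_(ka <- square_parts D | hstrip nu ka && (sumn ka + M ord_max == sumn nu)%N)
     (schur ka n)@_[multinom M (widen_ord (leqnSn n) i) | i < n].
Proof.
move=> sq; rewrite schurE (schur_eval_branch _ _ sq) raddf_sum /= big_mkcondr.
rewrite big_seq_cond [RHS]big_seq_cond; apply: eq_bigr => ka /andP[sqka st].
have pka := square_parts_part sqka; have pnu := square_parts_part sq.
have [le_sum _] := hstrip_sumn pnu pka st.
set w := [tuple 'X_(widen_ord (leqnSn n) i) | i < n] : n.-tuple {mpoly int[n.+1]}.
have -> : schur_eval (mvar n.+1) n ka = schur ka n \mPo w.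
  rewrite schurE (rmorph_schur_eval (comp_mpoly w)); apply: eq_schur_eval => i lt_i.
  have Xi : mvar n i = 'X_(Ordinal lt_i) by exact: (mvarE (Ordinal lt_i)).
  transitivity ('X_(Ordinal lt_i) \mPo w); last by rewrite -Xi.
  rewrite comp_mpolyXU -tnth_nth tnth_mktuple.
  exact: (mvarE (widen_ord (leqnSn n) (Ordinal lt_i))).
set e := (sumn nu - sumn ka)%N.
(* The power is written as a polynomial in one variable of its own, to which [mcoeff_join]
   applies. *)
have -> : mvar n.+1 n ^+ e =
  ('X_(ord0 : 'I_1) ^+ e) \mPo [tuple 'X_(ord_max : 'I_n.+1) | j < 1].
  rewrite rmorphXn /= comp_mpolyXU -tnth_nth tnth_mktuple.
  by rewrite -[RHS](congr1 (fun p => p ^+ e) (mvarE (ord_max : 'I_n.+1))).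
rewrite mulrC mcoeff_join.
- rewrite mcoeffXn mulr_natr mulrb.
  have -> : ((U_(ord0) *+ e)%MM == [multinom M ord_max | _ < 1])
      = (sumn ka + M ord_max == sumn nu)%N.
    rewrite -(subnKC le_sum) eqn_add2l -/e eq_sym.
    apply/eqP/eqP => [/mnmP/(_ ord0)|->]; first by rewrite mulmnE mnm1E eqxx mul1n mnmE.
    by apply/mnmP => i; rewrite mulmnE mnm1E !ord1 eqxx mul1n mnmE.
  by [].
- by move=> i j /(congr1 val) /= /ord_inj.
- by move=> i j _; rewrite !ord1.
- by move=> i j; rewrite -val_eqE /= neq_ltn ltn_ord.
move=> l; case: (unliftP ord_max l) => [j ->|->]; last by right; exists ord0.
by left; exists j; apply: ord_inj; rewrite lift_max.
Qed.

Lemma schur_nil n : schur [::] n = 1.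
Proof. by rewrite schurE schur_eval_nil. Qed.

Lemma conj_part_eq0 nu : is_part nu -> (conj_part nu == [::]) = (nu == [::]).
Proof.
move=> pnu; apply/eqP/eqP => [e|-> //].
by rewrite -(conj_partK pnu) e.
Qed.

Definition conj_if (v : bool) nu := if v then conj_part nu else nu.

(** Removing the last factor and removing the last variable give the same recursion over strips of
    size a (n-1). For the e_r the strips are vertical, and transposing makes them horizontal. *)
Lemma schur_coef_pieri_sym_prod v n (a : nat -> nat) nu : is_part nu ->
  schur_coef nu (\prod_(i < n) pieri_sym v (a i)) =
    (schur (conj_if v nu) n)@_(mnm_of n a).
Proof.
elim: n nu => [|n IHn] nu pnu.
  have -> : \prod_(i < 0) pieri_sym v (a i) = schur [::].
    by apply: fam1P => k; rewrite big_ord0 schur_nil.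
  rewrite schur_coef_schur // eq_sym.
  have pc : is_part (conj_if v nu) by case: v; rewrite ?conj_part_part.
  have <- : (conj_if v nu == [::]) = (nu == [::]) by case: v {pc};
    rewrite ?conj_part_eq0.
  case: eqP => [->|ne].
    by rewrite schur_nil mcoeff1; case: eqP => // -[]; apply/mnmP => -[].
  rewrite schur_eq0 ?mcoeff0 //; by case: (conj_if v nu) ne.
have sq : nu \in square_parts (sumn nu) by apply: square_parts_sumn.
rewrite big_ord_recr /= (schur_coef_pieri_sym_mul _ _ _ sq); last first.
  by apply: in_Lambda_prod => i _; apply: pieri_sym_in_Lambda.
have csq : conj_if v nu \in square_parts (sumn nu).
  by case: (v); rewrite ?conj_square_parts.
rewrite (schur_branch_coef _ csq).
apply: (reindex_seq (f := conj_if v)); rewrite ?square_parts_uniq //.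
- move=> ka sqka /andP[st sk]; have pka := square_parts_part sqka; split.
  + by case: (v); rewrite ?conj_square_parts.
  + by case: (v) st => /= st; rewrite ?hstrip_conj ?sumn_conj_part ?st //= mnmE.
  rewrite IHn //; congr (_@__); by apply/mnmP => i; rewrite !mnmE.
- move=> ka ka' /square_parts_part pka /square_parts_part pka' _ _.
  by case: (v) => //= /(congr1 conj_part); rewrite !conj_partK.
move=> ka sqka /andP[st sk]; have pka := square_parts_part sqka.
exists (conj_if v ka); last by case: (v) => //=; rewrite conj_partK.
rewrite mnmE in sk; case: (v) st sk => /= st sk; last by rewrite sqka st.
rewrite conj_square_parts //= -hstrip_conj ?conj_part_part // conj_partK // st.
by rewrite sumn_conj_part // -(sumn_conj_part pnu).
Qed.

(** * Adjunction and transposition *)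

(** An entry holds the number of factors, their indices and an integer coefficient. The list stays
    formal so that it can be read with the h_r or the e_r; switching [v] plays the part of omega. *)
Definition hsum (v : bool) (c : seq (nat * (nat -> nat) * int)) : fam1 :=
  \sum_(x <- c) (\prod_(i < x.1.1) pieri_sym v (x.1.2 i)) *~ x.2.

Definition catf n (a b : nat -> nat) i := if (i < n)%N then a i else b (i - n)%N.

Lemma pieri_sym_cat v n k (a b : nat -> nat) :
  (\prod_(i < n) pieri_sym v (a i)) * (\prod_(i < k) pieri_sym v (b i))
  = \prod_(i < n + k) pieri_sym v (catf n a b i).
Proof.
rewrite big_split_ord /=; congr (_ * _); apply: eq_bigr => i _; rewrite /catf /=.
  by rewrite ltn_ord.
by rewrite ltnNge leq_addr addKn.
Qed.

Lemma in_Lambda_hsum v c : in_Lambda (hsum v c).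
Proof.
apply: in_Lambda_sum => x _; apply: in_LambdaMz; apply: in_Lambda_prod => i _.
exact: pieri_sym_in_Lambda.
Qed.

Lemma hsum_omega c nu : is_part nu ->
  schur_coef nu (hsum false c) = schur_coef (conj_part nu) (hsum true c).
Proof.
move=> pnu; rewrite !schur_coef_sum; apply: eq_bigr => x _; rewrite !schur_coefMz.
by rewrite !schur_coef_pieri_sym_prod ?conj_part_part //= conj_partK.
Qed.

Definition hcat (x y : nat * (nat -> nat) * int) : nat * (nat -> nat) * int :=
  ((x.1.1 + y.1.1)%N, catf x.1.1 x.1.2 y.1.2, x.2 * y.2).

Lemma hsum_mul v c c' : hsum v c * hsum v c' = hsum v
  [seq hcat x y | x <- c, y <- c'].
Proof.
rewrite /hsum big_distrlr big_allpairs_dep /=; apply: eq_bigr => x _.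
apply: eq_bigr => y _; rewrite -pieri_sym_cat mulrzAl mulrzAr -mulrzA.
by rewrite (mulrC x.2).
Qed.

Lemma mnm_of_nth n (m : 'X_{1..n}) : mnm_of n (nth 0%N m) = m.
Proof. by apply/mnmP => i; rewrite mnmE -mnm_nth. Qed.

Lemma hsum_map v n (c : seq ((nat -> nat) * int)) :
  hsum v [seq (n, x.1, x.2) | x <- c]
  = \sum_(x <- c) (\prod_(i < n) pieri_sym v (x.1 i)) *~ x.2.
Proof. by rewrite /hsum big_map. Qed.

(* [c] lists the terms of the expanded Jacobi-Trudi determinant. *)
Lemma jacobi_trudi la n : is_part la -> (size la <= n)%N ->
  exists c : seq ((nat -> nat) * int),
    (forall f, in_Lambda f ->
       schur_coef la f = \sum_(x <- c) (f n)@_(mnm_of n x.1) * x.2) /\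
    schur la = hsum false [seq (n, x.1, x.2) | x <- c].
Proof.
move=> pla sla; set M := mnm_of n (add_delta n la).
pose d (s : 'S_n) := mnm_perm (mnm_of n (add_delta n [::])) s.
(* The coefficient 0 when d s does not divide stands for a vanishing h_r of negative index. *)
pose c := [seq (nth 0%N (M - d s)%MM, (-1) ^+ s * (d s <= M)%MM%:R) | s : 'S_n]
  : seq ((nat -> nat) * int).
have scE f : in_Lambda f -> schur_coef la f = \sum_(x <- c) (f n)@_(mnm_of n x.1) * x.2.
  move=> Lf; rewrite (schur_coefE Lf sla) /alt_coef coef_altM /c big_image.
  apply: eq_bigr => s _; rewrite -/M -/(d s) -[RHS]/((f n)@_(mnm_of n (nth 0%N (M -
    d s)%MM))
    * ((-1) ^+ s * (d s <= M)%MM%:R)) mnm_of_nth.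
  by case: ifP => _; rewrite ?mulr0 ?mulr1 // mulrC.
clearbody c; exists c; split=> //; apply: schur_coef_inj => [||nu pnu].
- exact: schur_in_Lambda.
- exact: in_Lambda_hsum.
(* The coefficient of s_nu in s_la is that of s_la in s_nu. Now [scE] turns it into monomial
   coefficients of s_nu, which are the coefficients of s_nu in products of the h_r. *)
rewrite schur_coef_schur // eq_sym -schur_coef_schur // scE;
  last exact: schur_in_Lambda.
rewrite hsum_map schur_coef_sum; apply: eq_bigr => x _ /=.
by rewrite schur_coefMz schur_coef_pieri_sym_prod.
Qed.

(** Read with the e_r, the Jacobi-Trudi list has its Schur coefficients transposed, by
    [hsum_omega]. *)
Lemma schur_hsum la : is_part la ->
  exists c, schur la = hsum false c /\ schur (conj_part la) = hsum true c.
Proof.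
move=> pla; have [c [_ ec]] := jacobi_trudi pla (leqnn _).
exists [seq (size la, x.1, x.2) | x <- c]; split=> //.
have pcla := conj_part_part pla.
apply: schur_coef_inj => [||nu pnu]; first exact: schur_in_Lambda.
  exact: in_Lambda_hsum.
have pcnu := conj_part_part pnu.
rewrite -[in RHS](conj_partK pnu) -hsum_omega // -ec !schur_coef_schur //.
congr (nat_of_bool _)%:R; apply/eqP/eqP => [<-|->]; first by rewrite conj_partK.
exact: conj_partK.
Qed.

(* omega maps the products of the h_r to the products of the e_r. *)
Lemma schur_coef_omega I (r : seq I) (F : I -> seq nat) nu :
  (forall i, is_part (F i)) -> is_part nu ->
  schur_coef nu (\prod_(i <- r) schur (F i))
  = schur_coef (conj_part nu) (\prod_(i <- r) schur (conj_part (F i))).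
Proof.
move=> pF pnu; suff [c [-> ->]] : exists c,
    \prod_(i <- r) schur (F i) = hsum false c /\
    \prod_(i <- r) schur (conj_part (F i)) = hsum true c by apply: hsum_omega.
elim: r => [|i r [c [e e']]].
  exists [:: (0%N, id, 1)].
  by rewrite /hsum !big_seq1 /= !big_ord0 !big_nil !mulr1z.
have [c1 [e1 e1']] := schur_hsum (pF i).
exists [seq hcat x y | x <- c1, y <- c].
by rewrite !big_cons e e' e1 e1' !hsum_mul.
Qed.

(** * Functions of two sets of variables and the coproduct *)

Lemma tensE f g n : tens f g n =
  ((f n : {mpoly int[n]}) \mPo [tuple 'X_(lshift n i) | i < n]) *
  ((g n : {mpoly int[n]}) \mPo [tuple 'X_(rshift n i) | i < n]).
Proof. by []. Qed.

Lemma fam2P (f g : fam2) : (forall n, f n = g n) -> f = g.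
Proof. by move=> eq_fg; apply: functional_extensionality_dep. Qed.

Lemma tensDl f f' g : tens (f + f') g = tens f g + tens f' g.
Proof. by apply: fam2P => n; rewrite famD !tensE fam1D rmorphD mulrDl. Qed.

Lemma tensDr f g g' : tens f (g + g') = tens f g + tens f g'.
Proof. by apply: fam2P => n; rewrite famD !tensE fam1D rmorphD mulrDr. Qed.

Lemma tensM f f' g g' : tens (f * f') (g * g') = tens f g * tens f' g'.
Proof. by apply: fam2P => n; rewrite famM !tensE !fam1M !rmorphM mulrACA. Qed.

Lemma tens1 : tens 1 1 = 1.
Proof. by apply: fam2P => n; rewrite tensE !rmorph1 mulr1. Qed.

Lemma tens0l g : tens 0 g = 0.
Proof. by apply: fam2P => n; rewrite tensE raddf0 mul0r. Qed.

Lemma tens0r f : tens f 0 = 0.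
Proof. by apply: fam2P => n; rewrite tensE raddf0 mulr0. Qed.

Lemma tensMzl f g a : tens (f *~ a) g = tens f g *~ a.
Proof. by apply: fam2P => n; rewrite famMz !tensE fam1Mz raddfMz mulrzAl. Qed.

Lemma tensMzr f g a : tens f (g *~ a) = tens f g *~ a.
Proof. by apply: fam2P => n; rewrite famMz !tensE fam1Mz raddfMz mulrzAr. Qed.

Lemma tens_prod I (r : seq I) F G :
  \prod_(i <- r) tens (F i) (G i) = tens (\prod_(i <- r) F i) (\prod_(i <- r) G i).
Proof.
elim: r => [|i r IHr]; first by rewrite !big_nil tens1.
by rewrite !big_cons IHr tensM.
Qed.

Lemma tens_suml I (r : seq I) F g :
  tens (\sum_(i <- r) F i) g = \sum_(i <- r) tens (F i) g.
Proof. by apply: (big_morph (fun f => tens f g)) => [? ?|];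
  rewrite ?tensDl ?tens0l. Qed.

Lemma tens_sumr I (r : seq I) f G :
  tens f (\sum_(i <- r) G i) = \sum_(i <- r) tens f (G i).
Proof. by apply: (big_morph (tens f)) => [? ?|]; rewrite ?tensDr ?tens0r. Qed.

Lemma tens_coef f g n a b : (tens f g n)@_(mnm_of (n + n) (catf n a b))
  = (f n)@_(mnm_of n a) * (g n)@_(mnm_of n b).
Proof.
rewrite tensE mcoeff_join.
- congr (_ * _); congr (_@__); apply/mnmP => i; rewrite !mnmE /catf /= ?ltn_ord //.
  by rewrite ltnNge leq_addr addKn.
- exact: lshift_inj.
- exact: rshift_inj.
- by move=> i j; rewrite eq_lrshift.
by move=> l; case: (split_ordP l) => i ->; [left|right]; exists i.
Qed.

Lemma mnm_of_catf n (M : 'X_{1..n + n}) :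
  M = mnm_of (n + n) (catf n (nth 0%N M) (fun i => nth 0%N M (n + i))).
Proof.
apply/mnmP => i; rewrite mnmE (mnm_nth 0%N) /catf; case: ltnP => // le_i.
by rewrite subnKC.
Qed.

(** The coproduct enters only through the values of [S] in n + n variables, split into two halves.
    The left side is the pairing of s_A s_B with [S], cut off at [D]. *)
Lemma adjunction D S (T : finType) (u v : T -> fam1) A B n :
  in_Lambda S -> S = schur_sum D S ->
  (forall t, in_Lambda (u t)) -> (forall t, in_Lambda (v t)) ->
  is_part A -> is_part B -> (size A <= n)%N -> (size B <= n)%N ->
  S (n + n)%N = \sum_t tens (u t) (v t) n ->
  \sum_(nu <- square_parts D) schur_coef nu (schur A * schur B) * schur_coef nu S
  = \sum_t schur_coef A (u t) * schur_coef B (v t).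
Proof.
move=> LS eS Lu Lv pA pB sA sB eST.
(* For products of the h_r, both sides are the coefficient of x^a y^b in [S]. Jacobi-Trudi for [A]
   and [B] then gives the general case by linearity. *)
have key (a b : nat -> nat) : \sum_(nu <- square_parts D)
    schur_coef nu ((\prod_(i < n) pieri_sym false (a i)) *
      (\prod_(i < n) pieri_sym false (b i))) * schur_coef nu S
  = \sum_t (u t n)@_(mnm_of n a) * (v t n)@_(mnm_of n b).
  under [RHS]eq_bigr do rewrite -tens_coef.
  rewrite -raddf_sum -eST /= [in RHS]eS /schur_sum fam1_sum raddf_sum /=.
  rewrite big_seq [RHS]big_seq; apply: eq_bigr => nu /square_parts_part pnu.
  rewrite pieri_sym_cat schur_coef_pieri_sym_prod // fam1Mz raddfMz /= -mulrzr intz //.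
have [ca [ca1 ca2]] := jacobi_trudi pA sA; have [cb [cb1 cb2]] := jacobi_trudi pB sB.
have -> : \sum_t schur_coef A (u t) * schur_coef B (v t) =
    \sum_(x <- ca) \sum_(y <- cb) (\sum_(nu <- square_parts D)
       schur_coef nu ((\prod_(i < n) pieri_sym false (x.1 i)) *
         (\prod_(i < n) pieri_sym false (y.1 i)))
       * schur_coef nu S) * (x.2 * y.2).
  under eq_bigr do rewrite ca1 // cb1 // big_distrlr /=.
  rewrite exchange_big; apply: eq_bigr => x _; rewrite exchange_big.
  apply: eq_bigr => y _; rewrite key mulr_suml; apply: eq_bigr => t _.
  by rewrite mulrACA.
rewrite ca2 cb2 !hsum_map.
under eq_bigr do rewrite big_distrlr schur_coef_sum mulr_suml.
rewrite exchange_big /=; apply: eq_bigr => x _.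
under eq_bigr do rewrite schur_coef_sum mulr_suml.
rewrite exchange_big /=; apply: eq_bigr => y _.
rewrite mulr_suml; apply: eq_bigr => nu _.
by rewrite mulrzAl mulrzAr -mulrzA schur_coefMz mulrAC [x.2 * _]mulrC.
Qed.

(* In [m] variables, both sides are alternating sums over the permutations,
   matched by conjugating with the reversal of the variables. *)
Lemma schur_coef_square m la mu : is_part la -> is_part mu ->
  schur_coef (rect m m) (schur la * schur mu)
  = ((la \in square_parts m) && (mu == dual_part m la))%:R.
Proof.
move=> pla pmu; have pR := rect_part m m.
have sR : (size (rect m m) <= m)%N by rewrite part_size_le // nth_rect ltnn.
have [Lla Lmu] := (schur_in_Lambda pla, schur_in_Lambda pmu).
rewrite (schur_coefE (in_LambdaM Lla Lmu) sR) fam1M /alt_coef mulrA.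
case: (leqP (size la) m) => [sla|lt_la]; last first.
  rewrite schur_eq0 // mulr0 mul0r mcoeff0; case: (boolP (la \in _)) => //.
  by case/square_partsP=> _; rewrite leqNgt lt_la.
rewrite {1}schurE bialternant // coef_altM.
case: (boolP (la \in square_parts m)) => [sq|nsq] /=; last first.
  (* The variable receiving the exponent la_0 + m - 1 has at most 2m - 1 available, which would
     force la_0 <= m. *)
  rewrite big1 // => s _; case: ifP => [/mnm_lepP le_m|]; rewrite ?mulr0 //.
  case/negP: nsq; apply/square_partsP; split=> // i.
  apply: leq_trans (part_nth_le pla (leq0n i)) _.
  case: (posnP m) => [m0|m_gt0].
    by rewrite nth_default // (leq_trans sla) // m0.
  have := le_m (s^-1 (Ordinal m_gt0))%g.
  rewrite mnm_permE permKV !mnmE /add_delta nth_rect ltn_ord /= => le_0.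
  have lt_s := ltn_ord (s^-1 (Ordinal m_gt0))%g.
  by move: le_0 lt_s; move: (nat_of_ord _) => k; move: (nth 0%N la 0) => l; lia.
have [dsq nd] := dual_partP sq; have pdual := square_parts_part dsq.
have /square_partsP[_ sd _] := dsq; have [_ _ nla] := square_partsP _ _ sq.
rewrite -(@alt_coef_schur m) // /alt_coef coef_altM.
pose r : 'S_m := perm (@rev_ord_inj m).
(* With r the reversal, this substitution keeps the sign and matches the two sums term by term. *)
rewrite (reindex_inj (h := fun s => (r * s^-1 * r)%g)); last first.
  by move=> s t /mulIg/mulgI/invg_inj.
apply: eq_bigr => s _; rewrite !odd_permM odd_permV addbC addbA addbb addFb.
congr (_ * _).
set N1 := mnm_perm (mnm_of m (add_delta m la)) _;
  set M1 := mnm_of m (add_delta m (rect m m)).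
set N2 := mnm_perm (mnm_of m (add_delta m [::])) s;
  set M2 := mnm_of m (add_delta m (dual_part m la)).
(* As integers, both M1 - N1 at r (s i) and M2 - N2 at i equal m + s i - i - la_(m-1-i). The
   remaining rearrangement is absorbed by the symmetry of s_mu. *)
have idx (i : 'I_m) : [/\ N1 (r (s i)) = (nth 0%N la (rev_ord i) + i)%N,
    M1 (r (s i)) = (m + s i)%N, N2 i = (m - (s i).+1)%N
    & M2 i = (m - nth 0%N la (rev_ord i) + (m - i.+1))%N].
  rewrite !mnm_permE !mnmE /add_delta !permM nth_rect ltn_ord nd ltn_ord nth_nil add0n.
  have -> : r (r (s i)) = s i by rewrite !permE rev_ordK.
  rewrite permK !permE /=; split=> //.
    by congr (_ + _)%N; have := ltn_ord i; lia.
  by congr (_ + _)%N; have := ltn_ord (s i); lia.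
have surj (k : 'I_m) : exists i, k = r (s i).
  by exists (s^-1 (r^-1 k))%g; rewrite !permKV.
have le_iff : (N1 <= M1)%MM = (N2 <= M2)%MM.
  apply/mnm_lepP/mnm_lepP => H k.
    have := H (r (s k)); have [-> -> -> ->] := idx k.
    have := nla (rev_ord k); have := ltn_ord k; have := ltn_ord (s k).
    move: (nat_of_ord (s k)) (nat_of_ord k) (nth 0%N la _) => a b c; lia.
  have [i ->] := surj k; have := H i; have [-> -> -> ->] := idx i.
  have := nla (rev_ord i); have := ltn_ord i; have := ltn_ord (s i).
  move: (nat_of_ord (s i)) (nat_of_ord i) (nth 0%N la _) => a b c; lia.
rewrite le_iff; case: ifP => // /mnm_lepP le2.
rewrite -(msym_coeff (M1 - N1)%MM (s * r)%g (Lambda_sym Lmu m)).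
congr (_@__); apply/mnmP => i; rewrite mnmE permM !mnmBE.
have [-> -> -> ->] := idx i; have := nla (rev_ord i).
have := ltn_ord i; have := ltn_ord (s i).
move: (nat_of_ord (s i)) (nat_of_ord i) (nth 0%N la _) => a b c; lia.
Qed.

(** The coefficient of x^a y^b on the left is that of s_(m^m) in h_a h_b. Expanding both factors in
    Schur functions, [schur_coef_square] keeps only the pairs of complementary shapes. *)
Lemma square_coproduct m n : (schur (rect m m)) (n + n)%N
  = \sum_(la <- square_parts m) tens (schur la) (schur (dual_part m la)) n.
Proof.
apply/mpolyP => M; rewrite [M]mnm_of_catf; set a := nth 0%N M; set b := fun i => _.
have pR := rect_part m m.
rewrite -[LHS](@schur_coef_pieri_sym_prod false _ (catf n a b) _ pR) -pieri_sym_cat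
  raddf_sum /=.
under [RHS]eq_bigr do rewrite tens_coef.
set ha := \prod_(i < n) pieri_sym false (a i);
  set hb := \prod_(i < n) pieri_sym false (b i).
have La : in_Lambda ha by apply: in_Lambda_prod => i _; apply: pieri_sym_in_Lambda.
have Lb : in_Lambda hb by apply: in_Lambda_prod => i _; apply: pieri_sym_in_Lambda.
have [da ea] := schur_expand La; have [db eb] := schur_expand Lb.
(* Large enough for both expansions and for the m x m square. *)
pose D := (da + db + m)%N.
have eA : ha = schur_sum D ha by apply: ea; rewrite /D; lia.
have eB : hb = schur_sum D hb by apply: eb; rewrite /D; lia.
rewrite [X in schur_coef _ (X * _)]eA [X in schur_coef _ (_ *
  X)]eB /schur_sum big_distrlr schur_coef_sum /=.
transitivity (\sum_(la <- square_parts D | la \in square_parts m)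
    (schur la n)@_(mnm_of n a) * (schur (dual_part m la) n)@_(mnm_of n b)).
  rewrite [RHS]big_mkcond big_seq [RHS]big_seq; apply: eq_bigr => la sqla.
  have pla := square_parts_part sqla.
  rewrite schur_coef_sum big_seq.
  rewrite (eq_bigr (fun mu => if (mu == dual_part m la) && (la \in square_parts m)
     then (schur la n)@_(mnm_of n a) * (schur mu n)@_(mnm_of n b) else 0)); last first.
    move=> mu /square_parts_part pmu.
    rewrite mulrzAl mulrzAr !schur_coefMz schur_coef_square //
      !schur_coef_pieri_sym_prod //= andbC.
    by case: ifP => _; rewrite ?mul0r // mul1r mulrC.
  case: ifP => sq; last by rewrite big1 // => mu _; rewrite andbF.
  have [dsq _] := dual_partP sq.
  have dD : dual_part m la \in square_parts D.
    by apply: square_parts_sub dsq; rewrite /D; lia.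
  rewrite -big_seq (bigD1_seq _ dD) ?square_parts_uniq //= eqxx big1 ?addr0 //.
  by move=> mu /negbTE ->.
apply: (reindex_seq (f := id)); rewrite ?square_parts_uniq //.
move=> la sq _; exists la => //; rewrite sq andbT; apply: square_parts_sub sq.
by rewrite /D; lia.
Qed.

(** * Pairings *)

Section Bilinear.
Variables (V : zmodType) (P : V -> Prop) (B : V -> V -> int).
Hypotheses (bilB : bilinear_on P B) (P0 : P 0).
Hypothesis PD : forall (a : int) f g, P f -> P g -> P (f *~ a + g).

Lemma bilinear_on_suml (I : eqType) (r : seq I) (F : I -> V) (c : I -> int) h :
  {in r, forall i, P (F i)} -> P h ->
  B (\sum_(i <- r) F i *~ c i) h = \sum_(i <- r) c i * B (F i) h.
Proof.
move=> PF Ph; suff [] : P (\sum_(i <- r) F i *~ c i) /\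
  B (\sum_(i <- r) F i *~ c i) h = \sum_(i <- r) c i * B (F i) h by [].
elim: r PF => [|i r IHr] PF.
  rewrite !big_nil; split=> //.
  (* B 0 h = 0 follows from 0 = 0 * 1 + 0, which gives B 0 h = B 0 h + B 0 h. *)
  have := bilB.1 1 0 0 h P0 P0 Ph; rewrite mul0rz addr0 mul1r.
  by move/eqP; rewrite -subr_eq0 opprD addrA subrr sub0r oppr_eq0 => /eqP.
have [|Pr IH] := IHr; first by move=> j rj; apply: PF; rewrite inE rj orbT.
have Pi : P (F i) by apply: PF; rewrite inE eqxx.
by rewrite !big_cons bilB.1 // IH; split=> //; apply: PD.
Qed.

Lemma bilinear_on_sumr (I : eqType) (r : seq I) (F : I -> V) (c : I -> int) h :
  {in r, forall i, P (F i)} -> P h ->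
  B h (\sum_(i <- r) F i *~ c i) = \sum_(i <- r) c i * B h (F i).
Proof.
move=> PF Ph; suff [] : P (\sum_(i <- r) F i *~ c i) /\
  B h (\sum_(i <- r) F i *~ c i) = \sum_(i <- r) c i * B h (F i) by [].
elim: r PF => [|i r IHr] PF.
  rewrite !big_nil; split=> //.
  have := bilB.2 1 0 0 h P0 P0 Ph; rewrite mul0rz addr0 mul1r.
  by move/eqP; rewrite -subr_eq0 opprD addrA subrr sub0r oppr_eq0 => /eqP.
have [|Pr IH] := IHr; first by move=> j rj; apply: PF; rewrite inE rj orbT.
have Pi : P (F i) by apply: PF; rewrite inE eqxx.
by rewrite !big_cons bilB.2 // IH; split=> //; apply: PD.
Qed.

End Bilinear.

Lemma in_Lambda_axpy (a : int) f g :
  in_Lambda f -> in_Lambda g -> in_Lambda (f *~ a + g).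
Proof. by move=> Lf Lg; apply: in_LambdaD => //; apply: in_LambdaMz. Qed.

Lemma in_Lambda20 : in_Lambda2 0.
Proof. by exists [::]; rewrite ?big_nil. Qed.

Lemma in_Lambda2_axpy (a : int) F G :
  in_Lambda2 F -> in_Lambda2 G -> in_Lambda2 (F *~ a + G).
Proof.
move=> [s Ls ->] [s' Ls' ->].
exists ([seq (p.1 *~ a, p.2) | p <- s] ++ s') => [p|].
  rewrite mem_cat => /orP[/mapP[q sq ->]|/Ls'//]; have [L1 L2] := Ls q sq.
  by split=> //=; apply: in_LambdaMz.
rewrite big_cat big_map /= mulrz_suml; congr (_ + _).
by apply: eq_bigr => p _; rewrite tensMzl.
Qed.

Lemma in_Lambda2_tens f g : in_Lambda f -> in_Lambda g -> in_Lambda2 (tens f g).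
Proof.
move=> Lf Lg; exists [:: (f, g)]; last by rewrite big_seq1.
by move=> p; rewrite inE => /eqP ->.
Qed.

(** The expansion of [g] over the same square is returned as well, since [adjunction] asks for
    it. *)
Lemma schur_pairingE B f g : schur_pairing B -> in_Lambda f -> in_Lambda g ->
  exists d, forall D, (d <= D)%N -> g = schur_sum D g /\
    B f g = \sum_(nu <- square_parts D) schur_coef nu f * schur_coef nu g.
Proof.
move=> [bilB orthB] Lf Lg.
have [df ef] := schur_expand Lf; have [dg eg] := schur_expand Lg.
exists (df + dg)%N => D le_D.
have eg' : g = schur_sum D g by apply: eg; apply: leq_trans le_D; apply: leq_addl.
have ef' : f = schur_sum D f by apply: ef; apply: leq_trans le_D; apply: leq_addr.
split=> //; rewrite {1}ef' {1}eg' /schur_sum.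
have Ls nu : nu \in square_parts D -> in_Lambda (schur nu).
  by move/square_parts_part; apply: schur_in_Lambda.
rewrite (bilinear_on_suml bilB in_Lambda0 in_Lambda_axpy) //; last first.
  exact/in_Lambda_schur_sum/square_parts_is_part.
rewrite big_seq [RHS]big_seq; apply: eq_bigr => nu sq; congr (_ * _).
rewrite (bilinear_on_sumr bilB in_Lambda0 in_Lambda_axpy) //; last exact: Ls.
rewrite (bigD1_seq nu) ?square_parts_uniq //= orthB ?(square_parts_part sq) //.
rewrite eqxx mulr1 big_seq_cond big1 ?addr0 // => ka /andP[sqka ne].
rewrite orthB ?(square_parts_part sq) ?(square_parts_part sqka) //.
by rewrite eq_sym (negbTE ne) mulr0.
Qed.

Lemma schur_pairing2E B f g be : schur_pairing2 B ->
  in_Lambda f -> in_Lambda g -> is_part be ->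
  B (tens f g) (tens (schur be) (schur be)) = schur_coef be f * schur_coef be g.
Proof.
move=> [bilB orthB] Lf Lg pbe; set sbe := tens (schur be) (schur be).
have Lbe : in_Lambda2 sbe.
  by apply: in_Lambda2_tens; apply: schur_in_Lambda.
have half f' : in_Lambda f' -> exists d, forall D, (d <= D)%N ->
    f' = schur_sum D f' /\ be \in square_parts D.
  move=> Lf'; have [d e] := schur_expand Lf'; exists (d + sumn be)%N => D le_D.
  split; first by apply: e; apply: leq_trans le_D; apply: leq_addr.
  by apply: square_parts_sumn => //; apply: leq_trans le_D; apply: leq_addl.
have pick1 D (c : seq nat -> int) : be \in square_parts D ->
    \sum_(nu <- square_parts D) c nu * (nu == be)%:R = c be.
  move=> sq; rewrite (bigD1_seq be) ?square_parts_uniq //= eqxx mulr1 big1 ?addr0 //.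
  by move=> nu /negbTE ->; rewrite mulr0.
have step nu : is_part nu ->
  B (tens (schur nu) g) sbe = (nu == be)%:R * schur_coef be g.
  move=> pnu; have [d e] := half g Lg; have [eg sq] := e d (leqnn d).
  rewrite {1}eg /schur_sum tens_sumr.
  under eq_bigr do rewrite tensMzr.
  rewrite (bilinear_on_suml bilB in_Lambda20 in_Lambda2_axpy) //; last first.
    by move=> ka /square_parts_part pka; apply: in_Lambda2_tens; apply: schur_in_Lambda.
  rewrite -(@pick1 d (fun ka => schur_coef ka g)) // mulr_sumr.
  rewrite big_seq [RHS]big_seq; apply: eq_bigr => ka /square_parts_part pka.
  by rewrite orthB // -mulnb natrM mulrCA.
have [d e] := half f Lf; have [ef sq] := e d (leqnn d).
rewrite {1}ef /schur_sum tens_suml.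
under eq_bigr do rewrite tensMzl.
rewrite (bilinear_on_suml bilB in_Lambda20 in_Lambda2_axpy) //; last first.
  move=> ka /square_parts_part pka; apply: in_Lambda2_tens => //.
  exact: schur_in_Lambda.
rewrite -[in RHS](@pick1 d (fun nu => schur_coef nu f)) // mulr_suml.
rewrite big_seq [RHS]big_seq; apply: eq_bigr => nu /square_parts_part pnu.
by rewrite step // mulrA.
Qed.

(** * Powers of the coproduct and the final identity *)

Lemma famX (R : nat -> comNzRingType) (f : Defs.family R) k n : (f ^+ k) n = f n ^+ k.
Proof. by elim: k => [|k IHk] //; rewrite !exprS famM IHk. Qed.

(** A term of the expanded power chooses one partition for each of the K factors. Choices are
    recorded as positions in [s], which form a finite type. *)
Lemma tens_sum_exp (s : seq (seq nat)) (F G : seq nat -> fam1) K :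
  (\sum_(la <- s) tens (F la) (G la)) ^+ K
  = \sum_(t : {ffun 'I_K -> 'I_(size s)})
      tens (\prod_i F (nth [::] s (t i))) (\prod_i G (nth [::] s (t i))).
Proof.
rewrite (big_nth [::]) big_mkord -[K in LHS]card_ord -prodr_const.
rewrite bigA_distr_bigA /=; apply: eq_bigr => t _.
exact: tens_prod.
Qed.

Theorem proposition3 (m k n : nat) (hm : (0 < m)%N) (hk : (0 < k)%N)
    (hn : n = (k * m)%N)
    (pairing : fam1 -> fam1 -> int) (pairing2 : fam2 -> fam2 -> int)
    (hpairing : schur_pairing pairing) (hpairing2 : schur_pairing2 pairing2) :
  pairing (schur (rect m (n - m)) * schur (rect (n - m) m))
          (schur (rect m m) ^+ (2 * (k - 1)))
  = pairing2
      ((\sum_(la <- square_parts m)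
          tens (schur la) (schur (conj_part (dual_part m la))))
         ^+ (2 * (k - 1)))
      (tens (schur (rect (n - m) m)) (schur (rect (n - m) m))).
Proof.
move: (n - m)%N (2 * (k - 1))%N => N K.
set A := rect m N; set B := rect N m; set S := schur (rect m m) ^+ K.
have [pA pB pR] := And3 (rect_part m N) (rect_part N m) (rect_part m m).
have LS : in_Lambda S by apply/in_LambdaX/schur_in_Lambda.
have LAB : in_Lambda (schur A * schur B) by apply: in_LambdaM; apply: schur_in_Lambda.
pose sq := square_parts m; pose L (j : 'I_(size sq)) := nth [::] sq j.
have Lsq j : L j \in sq by apply: mem_nth.
have Lpart j : is_part (L j) := square_parts_part (Lsq j).
have Ldual j : is_part (dual_part m (conj_part (L j))).
  by have [/square_parts_part] := dual_partP (conj_square_parts (Lsq j)).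
(* [u] and [u'] differ by transposing every shape, while [v] is shared by the two sides of the
   identity. *)
pose u (t : {ffun 'I_K -> 'I_(size sq)}) := \prod_i schur (conj_part (L (t i))).
pose u' (t : {ffun 'I_K -> 'I_(size sq)}) := \prod_i schur (L (t i)).
pose v (t : {ffun 'I_K -> 'I_(size sq)}) :=
  \prod_i schur (dual_part m (conj_part (L (t i)))).
have Lu t : in_Lambda (u t).
  by apply: in_Lambda_prod => i _; apply/schur_in_Lambda/conj_part_part.
have Lu' t : in_Lambda (u' t) by apply: in_Lambda_prod => i _; apply: schur_in_Lambda.
have Lv t : in_Lambda (v t) by apply: in_Lambda_prod => i _; apply: schur_in_Lambda.
have -> : (\sum_(la <- square_parts m)
    tens (schur la) (schur (conj_part (dual_part m la)))) ^+ K
    = \sum_t tens (u' t) (v t).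
  rewrite (@tens_sum_exp _ _ (fun la => schur (conj_part (dual_part m la)))).
  apply: eq_bigr => t _; congr tens; apply: eq_bigr => i _.
  by rewrite -dual_conj // Lsq.
(* The coproduct of the power is the power of the coproduct; summing over transposes brings its
   second factors to the form of [v]. *)
have coprod N' : S (N' + N')%N = \sum_t tens (u t) (v t) N'.
  transitivity ((\sum_t tens (u t) (v t)) N'); last exact: fam_sumE.
  transitivity (((\sum_(la <- sq) tens (schur la) (schur (dual_part m la))) ^+ K) N').
    by rewrite /S !famX square_coproduct fam_sumE.
  congr ((_ : fam2) N').
  rewrite -(@tens_sum_exp sq (fun la => schur (conj_part la))
    (fun la => schur (dual_part m (conj_part la)))); congr (_ ^+ K).
  apply/esym; apply: (reindex_seq (f := conj_part)); rewrite ?square_parts_uniq //.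
  - by move=> la sqla _; rewrite conj_square_parts.
  - move=> la mu /square_parts_part pla /square_parts_part pmu _ _.
    by move/(congr1 conj_part); rewrite !conj_partK.
  move=> la sqla _; exists (conj_part la); first by rewrite conj_square_parts.
  by rewrite conj_partK // (square_parts_part sqla).
have [D eD] := schur_pairingE hpairing LAB LS.
have [eS ->] := eD D (leqnn D).
(* Enough variables in each half for both rectangles. *)
pose M := maxn (size A) (size B).
rewrite (adjunction LS eS Lu Lv pA pB (leq_maxl _ _) (leq_maxr _ _) (coprod M)).
have -> : \sum_t tens (u' t) (v t) = \sum_t tens (u' t) (v t) *~ 1.
  by apply: eq_bigr => t _; rewrite mulr1z.
rewrite (bilinear_on_suml hpairing2.1 in_Lambda20 in_Lambda2_axpy); last 2 first.
- by move=> t _; apply: in_Lambda2_tens.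
- by apply: in_Lambda2_tens; apply: schur_in_Lambda.
apply: eq_bigr => t _; rewrite mul1r schur_pairing2E //; congr (_ * _).
(* Omega turns the coefficient of [A] in [u t] into that of its transpose [B] in [u' t]. *)
rewrite schur_coef_omega //; last by move=> i; apply: conj_part_part.
rewrite conj_rect; congr schur_coef; apply: eq_bigr => i _.
by rewrite conj_partK.
Qed.
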